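(* Let $q_1,q_2>1$ be integers. The newform Dedekind sums $S_{\chi_1,\chi_2}$, indexed by all ordered pairs $(\chi_1,\chi_2)$ of primitive Dirichlet characters $\chi_1$ modulo $q_1$ and $\chi_2$ modulo $q_2$ with $\chi_1\chi_2(-1)=1$, are (when restricted to $\Gamma_1(q_1q_2)$) linearly independent over $\mathbb{C}$ in $\mathrm{Hom}(\Gamma_1(q_1q_2),\mathbb{C})$.
   Context: $\Gamma_0(N)=\{\begin{pmatrix}a&b\\c&d\end{pmatrix}\in SL_2(\mathbb{Z}): N\mid c\}$, and $\Gamma_1(N)$ is the subgroup of those matrices in $\Gamma_0(N)$ with $a\equiv d\equiv 1\pmod N$. $\mathrm{Hom}(\Gamma_1(N),\mathbb{C})$ is the complex vector space of group homomorphisms from $\Gamma_1(N)$ to $(\mathbb{C},+)$. $B_1(x)=0$ if $x\in\mathbb{Z}$ and $B_1(x)=x-\lfloor x\rfloor-\tfrac12$ otherwise. Newform Dedekind sum $S_{\chi_1,\chi_2}:\Gamma_0(q_1q_2)\to\mathbb{C}$: put $\psi=\chi_1\overline{\chi_2}$ (a Dirichlet character modulo $q_1q_2$), $\psi(\gamma)=\psi(d)$ for $\gamma=\begin{pmatrix}a&b\\c&d\end{pmatrix}\in\Gamma_0(q_1q_2)$, and, for $z$ in the upper half plane, $f_{\chi_1,\chi_2}(z)=\sum_{n\ge1}\Big(\sum_{ab=n}\frac{\chi_1(a)\overline{\chi_2}(b)}{a}\Big)e^{2\pi i n z}$. Then $S_{\chi_1,\chi_2}(\gamma)=\frac{\tau(\overline{\chi_1})}{\pi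 i}\big(f_{\chi_1,\chi_2}(\gamma z)-\psi(\gamma)f_{\chi_1,\chi_2}(z)\big)$, where $\tau$ denotes the Gauss sum; this is independent of $z$. Equivalently (known result): if $\gamma=\begin{pmatrix}h&*\\k&l\end{pmatrix}\in\Gamma_0(q_1q_2)$ with $k\ge1$, then $$S_{\chi_1,\chi_2}(\gamma)=\sum_{j \bmod k}\ \sum_{n \bmod q_1}\overline{\chi_2}(j)\,\overline{\chi_1}(n)\,B_1\!\left(\tfrac{j}{k}\right)B_1\!\left(\tfrac{n}{q_1}+\tfrac{hj}{k}\right);$$ moreover $S_{\chi_1,\chi_2}(-\gamma)=S_{\chi_1,\chi_2}(\gamma)$, and $S_{\chi_1,\chi_2}(\gamma)=0$ if $k=0$. It satisfies $S_{\chi_1,\chi_2}(\gamma_1\gamma_2)=S_{\chi_1,\chi_2}(\gamma_1)+\psi(\gamma_1)S_{\chi_1,\chi_2}(\gamma_2)$ (known), so it restricts to a homomorphism on $\Gamma_1(q_1q_2)$. *)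

(* Defs.v *)
From HB Require Import structures.
From mathcomp Require Import all_boot all_order all_algebra.
From mathcomp Require Import all_classical all_reals all_analysis.
From mathcomp Require Export complex.
Import Order.TTheory GRing.Theory Num.Theory numFieldNormedType.Exports.

Set Implicit Arguments.
Unset Strict Implicit.
Unset Printing Implicit Defensive.

Local Open Scope ring_scope.
Local Open Scope complex_scope.

(* Matrices of SL_2(Z); rows and columns are indexed by 0 and 1 in 'I_2. *)
Definition Gamma0 (N : nat) (g : 'M[int]_2) : Prop :=
  \det g = 1 /\ (N%:Z %| g 1%R 0%R)%Z.

Definition Gamma1 (N : nat) (g : 'M[int]_2) : Prop :=
  [/\ Gamma0 N g, (g 0%R 0%R = 1 %[mod N%:Z])%Z & (g 1%R 1%R = 1 %[mod N%:Z])%Z].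

Definition dirichlet_character (R : realType) (q : nat) (chi : int -> R[i]) : Prop :=
  [/\ chi 1 = 1,
      forall m n, chi (m * n) = chi m * chi n,
      forall n, chi (n + q%:Z) = chi n
    & forall n, (chi n != 0) = coprimez n q%:Z].

(* No proper divisor d of q is an induced modulus of chi, i.e. chi is
   nontrivial on the units modulo q that are congruent to 1 modulo d. *)
Definition primitive_character (R : realType) (q : nat) (chi : int -> R[i]) : Prop :=
  dirichlet_character q chi /\
  forall d : nat, (d %| q)%N -> (d < q)%N ->
    ~ (forall n : int, coprimez n q%:Z -> (n = 1 %[mod d%:Z])%Z -> chi n = 1).

Definition conj_character (R : realType) (chi : int -> R[i]) : int -> R[i] :=
  fun n => (chi n)^*.

(* e2pi z = exp(2 pi i z) *)
Definition e2pi (R : realType) (z : R[i]) : R[i] :=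
  (expR (- (2 * pi * complex.Im z)))%:C *
  (cos (2 * pi * complex.Re z) +i* sin (2 * pi * complex.Re z)).

Definition gauss_sum (R : realType) (q : nat) (chi : int -> R[i]) : R[i] :=
  \sum_(n < q) chi n%:Z * e2pi (n%:R / q%:R).

(* R[i]^o is R[i] with the topology of its modulus; `divisors n` runs over the
   first factors a of the factorizations n = a * b. *)
Definition eichler_series (R : realType) (chi1 chi2 : int -> R[i]) (z : R[i]) : R[i] :=
  limn (fun m => \sum_(1 <= n < m)
    (\sum_(a <- divisors n) chi1 a%:Z * conj_character chi2 (n %/ a)%N%:Z / a%:R)
      * e2pi (n%:R * z) : R[i]^o).

Definition mobius (R : realType) (g : 'M[int]_2) (z : R[i]) : R[i] :=
  ((g 0 0)%:~R * z + (g 0 1)%:~R) / ((g 1 0)%:~R * z + (g 1 1)%:~R).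

Definition psi_character (R : realType) (chi1 chi2 : int -> R[i]) (g : 'M[int]_2) : R[i] :=
  chi1 (g 1 1) * conj_character chi2 (g 1 1).

(* For chi1 modulo q1, the value at g of the newform Dedekind sum, computed at
   the point z of the upper half plane.  For primitive characters with
   chi1 chi2 (-1) = 1 and g in Gamma0 (q1 * q2) it does not depend on z. *)
Definition newform_dedekind_sum (R : realType) (q1 : nat) (chi1 chi2 : int -> R[i])
    (z : R[i]) (g : 'M[int]_2) : R[i] :=
  gauss_sum q1 (conj_character chi1) / (pi%:C * 'i%C) *
  (eichler_series chi1 chi2 (mobius g z)
   - psi_character chi1 chi2 g * eichler_series chi1 chi2 z).

Definition admissible_pair (R : realType) (q1 q2 : nat)
    (p : (int -> R[i]) * (int -> R[i])) : Prop :=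
  [/\ primitive_character q1 p.1, primitive_character q2 p.2
    & p.1 (-1) * p.2 (-1) = 1].

(* Linear independence over K of the family (F i) indexed by the i with P i,
   as functions on D: no nontrivial relation between finitely many distinct
   indices. *)
Definition linearly_independent_on (K : fieldType) (I T : Type)
    (P : I -> Prop) (D : T -> Prop) (F : I -> T -> K) : Prop :=
  forall (n : nat) (s : 'I_n -> I), injective s -> (forall k, P (s k)) ->
  forall c : 'I_n -> K,
    (forall x, D x -> \sum_(k < n) c k * F (s k) x = 0) ->
    forall k, c k = 0.

(* Main.v *)
(**
  Grouping the Eichler series by its first factor gives
    f (z) = \sum_(a >= 1) chi1 a / a * K (a z),
  where K w = \sum_(b >= 1) conj (chi2 b) e (b w) is a rational function of e w, with poles
  only at the points of q2^-1 Z and |K w| <= q2 / Im w.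

  On Gamma1 (q1 q2) the multiplier psi is trivial, so a linear relation between the
  Dedekind sums says that a combination F of the series f satisfies F (g z) = F z for all g
  in Gamma1 (q1 q2), z being fixed.  Apply this to the powers of a parabolic element fixing
  h / (q2 m), with gcd (h, m) = 1: the orbit is h / (q2 m) + zeta_n with zeta_n -> 0 along a
  horocycle.  There (1 - e (q2 zeta_n)) f (h / (q2 m) + zeta_n) tends to
    chi1 (m) chi2 (h) tau (conj chi2) m^-2 L (2, chi1 chi2),
  which is found term by term.  Exchanging limit and sum is the delicate point, since the
  approach is tangential: with d = |Re zeta_n| and Im zeta_n of order d^2, the terms with
  a d small are dominated by 1 / (a^2 d); among the other a below a multiple of 1 / d, only
  boundedly many have a z within a multiple of d of a pole; the larger a are negligible by
  the bound on K.

  As F (h / (q2 m) + zeta_n) is constant, the same combination of these limits vanishes for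
  all m and h.  Independence of the characters (m, h) |-> chi1 (m) chi2 (h), together with
  tau <> 0 (primitivity) and L (2, chi1 chi2) <> 0, concludes.
*)

Require Import Defs.
From mathcomp Require Import all_boot all_order all_algebra.
From mathcomp Require Import all_classical all_reals all_analysis.
From mathcomp Require Import cyclic ring lra zify.
Import Order.TTheory GRing.Theory Num.Theory numFieldNormedType.Exports.

Set Implicit Arguments.
Unset Strict Implicit.
Unset Printing Implicit Defensive.

Local Open Scope classical_set_scope.
Local Open Scope ring_scope.
Local Open Scope complex_scope.

(** * Real modulus on [R[i]], convergence criteria, and series dominated by inverse squares *)

Section Modulus.
Variable R : realType.
Implicit Types z w : R[i].

(* The norm of R[i] takes values in R[i]; estimates are done with this real modulus. *)
Definition cabs z : R := ComplexField.Normc.normc z.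

Lemma normE z : `|z| = (cabs z)%:C.
Proof. by case: z. Qed.

Lemma cabs_ge0 z : 0 <= cabs z.
Proof. by rewrite -ler0c -normE. Qed.

Lemma cabs0 : cabs 0 = 0.
Proof. by apply: (@complexI R); rewrite -normE normr0. Qed.

Lemma cabs1 : cabs 1 = 1.
Proof. by apply: (@complexI R); rewrite -normE normr1. Qed.

Lemma cabs0_eq0 z : cabs z = 0 -> z = 0.
Proof. by move=> h; apply/eqP; rewrite -normr_eq0 normE h. Qed.

Lemma cabsM z w : cabs (z * w) = cabs z * cabs w.
Proof. by apply: (@complexI R); rewrite rmorphM -!normE normrM. Qed.

Lemma cabsV z : cabs z^-1 = (cabs z)^-1.
Proof. by apply: (@complexI R); rewrite fmorphV -!normE normfV. Qed.

Lemma cabsN z : cabs (- z) = cabs z.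
Proof. by apply: (@complexI R); rewrite -!normE normrN. Qed.

Lemma cabsB z w : cabs (z - w) = cabs (w - z).
Proof. by rewrite -cabsN opprB. Qed.

Lemma cabsD z w : cabs (z + w) <= cabs z + cabs w.
Proof. by rewrite -lecR rmorphD /= -!normE ler_normD. Qed.

Lemma cabsBD z w : cabs (z - w) <= cabs z + cabs w.
Proof. by rewrite -(cabsN w) cabsD. Qed.

Lemma cabsX z n : cabs (z ^+ n) = cabs z ^+ n.
Proof. by elim: n => [|n IH]; rewrite ?expr0 ?cabs1 // !exprS cabsM IH. Qed.

Lemma cabs_nat n : cabs n%:R = n%:R.
Proof. by apply: (@complexI R); rewrite -normE normr_nat rmorph_nat. Qed.

Lemma cabs_real (x : R) : cabs x%:C = `|x|.
Proof. by rewrite /cabs /= expr0n addr0 sqrtr_sqr. Qed.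

Lemma cabs_sqr z : cabs z ^+ 2 = complex.Re z ^+ 2 + complex.Im z ^+ 2.
Proof. by case: z => a b /=; rewrite /cabs /= sqr_sqrtr // addr_ge0 // sqr_ge0. Qed.

Lemma Re_le_cabs z : `|complex.Re z| <= cabs z.
Proof.
rewrite -(@ler_pXn2r _ 2) ?nnegrE ?normr_ge0 ?cabs_ge0 // cabs_sqr -normrX.
by rewrite ger0_norm ?sqr_ge0 // lerDl sqr_ge0.
Qed.

Lemma Im_le_cabs z : `|complex.Im z| <= cabs z.
Proof.
rewrite -(@ler_pXn2r _ 2) ?nnegrE ?normr_ge0 ?cabs_ge0 // cabs_sqr -normrX.
by rewrite ger0_norm ?sqr_ge0 // lerDr sqr_ge0.
Qed.

Lemma cabs_le_ReIm z : cabs z <= `|complex.Re z| + `|complex.Im z|.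
Proof.
rewrite -(@ler_pXn2r _ 2) ?nnegrE ?addr_ge0 ?normr_ge0 ?cabs_ge0 // cabs_sqr.
rewrite sqrrD !real_normK ?num_real // -addrA lerD2l lerDr.
by rewrite mulrn_wge0 ?mulr_ge0.
Qed.

Lemma cabs_sum (I : Type) (r : seq I) (P : pred I) (F : I -> R[i]) :
  cabs (\sum_(i <- r | P i) F i) <= \sum_(i <- r | P i) cabs (F i).
Proof.
elim/big_ind2: _ => [|x x' y y' hx hy|//]; first by rewrite cabs0.
by rewrite (le_trans (cabsD _ _)) ?lerD.
Qed.

Lemma cvg_cabsP (u : nat -> R[i]) (l : R[i]) :
  (forall e : R, 0 < e -> exists M, forall n, (M <= n)%N -> cabs (u n - l) <= e) <->
  ((u : nat -> R[i]^o) @ \oo --> (l : R[i]^o)).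
Proof.
split=> [h|].
  apply/cvgrPdist_le => -[e e'] /=; rewrite ltcE /= => /andP[/eqP -> e0].
  have [M hM] := h _ e0.
  exists M => // n /= Mn; rewrite normE complexr0 lecR cabsB; exact: hM.
move=> /cvgrPdist_le h e e0.
have e0' : 0 < e%:C by rewrite ltcR.
have [M _ hM] := h _ e0'.
exists M => n Mn; rewrite cabsB -lecR -normE; exact: hM.
Qed.

Lemma cauchy_cvg_real (u : nat -> R) :
  (forall e : R, 0 < e -> exists M, forall n, (M <= n)%N -> `|u n - u M| <= e) ->
  cvgn u.
Proof.
move=> h; apply/cauchy_cvgP; apply: cauchy_exP => e e0.
have e2 : 0 < e / 2 by rewrite divr_gt0.
have [M hM] := h _ e2.
exists (u M), M => // n /= Mn; rewrite /ball /= distrC.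
by rewrite (le_lt_trans (hM _ Mn)) // ltr_pdivrMr // ltr_pMr // ltr1n.
Qed.

Lemma cauchy_cvg_complex (u : nat -> R[i]) :
  (forall e : R, 0 < e -> exists M, forall n, (M <= n)%N -> cabs (u n - u M) <= e) ->
  exists l : R[i], (u : nat -> R[i]^o) @ \oo --> (l : R[i]^o).
Proof.
move=> h.
have cRe : cvgn (fun n => complex.Re (u n)).
  apply: cauchy_cvg_real => e /h[M hM]; exists M => n /hM; apply: le_trans.
  by rewrite (le_trans _ (Re_le_cabs _)) // raddfB.
have cIm : cvgn (fun n => complex.Im (u n)).
  apply: cauchy_cvg_real => e /h[M hM]; exists M => n /hM; apply: le_trans.
  by rewrite (le_trans _ (Im_le_cabs _)) // raddfB.
exists (limn (fun n => complex.Re (u n)) +i* limn (fun n => complex.Im (u n))).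
apply/cvg_cabsP => e e0.
have e2 : 0 < e / 2 by rewrite divr_gt0.
have [M1 _ h1] := (cvgrPdist_le _ _).1 cRe _ e2.
have [M2 _ h2] := (cvgrPdist_le _ _).1 cIm _ e2.
exists (maxn M1 M2) => n; rewrite geq_max => /andP[n1 n2].
rewrite (le_trans (cabs_le_ReIm _)) // [leRHS](splitr e) lerD //.
  by rewrite raddfB /= distrC; exact: h1.
by rewrite raddfB /= distrC; exact: h2.
Qed.

(** Telescoping: [1 / k ^ 2 <= 2 / (k (k + 1)) = 2 / k - 2 / (k + 1)] for [k >= 1]. The induction
    runs on the sharper bound [2 / M - 2 / M']. *)
Lemma sum_inv_sqr (M M' : nat) : (0 < M)%N ->
  \sum_(M <= a < M') (a%:R ^+ 2)^-1 <= 2 / M%:R :> R.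
Proof.
move=> M0.
have [MM'|/ltnW MM'] := leqP M M'; last by rewrite big_geq // divr_ge0.
suff: \sum_(M <= a < M') (a%:R ^+ 2)^-1 <= 2 / M%:R - 2 / M'%:R :> R.
  by move/le_trans; apply; rewrite gerBl divr_ge0.
elim: M' MM' => [|k IH]; first by rewrite leqn0 => /eqP M0'; rewrite M0' in M0.
rewrite leq_eqVlt => /orP[/eqP <-|]; first by rewrite big_geq // subrr.
rewrite ltnS => Mk; rewrite big_nat_recr //=.
have k0 : 0 < k%:R :> R by rewrite ltr0n (leq_trans M0).
have k1 : 1 <= k%:R :> R by rewrite ler1n (leq_trans M0).
have -> : 2 / M%:R - 2 / k.+1%:R = (2 / M%:R - 2 / k%:R) + 2 / (k%:R * (k%:R + 1)) :> R.
  rewrite -natr1; field.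
  by rewrite (gt_eqF k0) /= pnatr_eq0 -lt0n M0 andbT gt_eqF // addr_gt0.
rewrite lerD ?IH // ler_pdivlMr; last by rewrite mulr_gt0 // addr_gt0.
rewrite mulrC ler_pdivrMr ?exprn_gt0 //; nra.
Qed.

Lemma sum_cabs_inv_sqr (g : nat -> R[i]) (C : R) (M M' : nat) : (0 < M)%N -> 0 <= C ->
  (forall a, (0 < a)%N -> cabs (g a) <= C / a%:R ^+ 2) ->
  cabs (\sum_(M <= a < M') g a) <= 2 * C / M%:R.
Proof.
move=> M0 C0 hg.
rewrite (le_trans (cabs_sum _ _ _)) //.
apply: (@le_trans _ _ (\sum_(M <= a < M') C * (a%:R ^+ 2)^-1)).
  by apply: ler_sum_nat => a /andP[Ma _]; apply: hg; exact: leq_trans Ma.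
by rewrite -mulr_sumr [2 * C]mulrC -mulrA ler_wpM2l // sum_inv_sqr.
Qed.

Lemma near_inv_nat (C e : R) : 0 < e ->
  exists M : nat, forall n, (M <= n)%N -> (0 < n)%N /\ C / n%:R <= e.
Proof.
move=> e0.
exists (Num.truncn (`|C| / e)).+1 => n hn.
have n0 : (0 < n)%N by exact: leq_trans hn.
split=> //; rewrite ler_pdivrMr ?ltr0n // mulrC.
rewrite (le_trans (ler_norm C)) // -ler_pdivrMr //.
apply: (le_trans (ltW (truncnS_gt _))).
by rewrite ler_nat.
Qed.

(** Absolute convergence by domination. The explicit tail bound is kept because later truncations
    take place at an index that moves with the point. *)
Lemma cvg_inv_sqr_series (g : nat -> R[i]) (C : R) : 0 <= C ->
  (forall a, (0 < a)%N -> cabs (g a) <= C / a%:R ^+ 2) ->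
  exists l : R[i],
    ((fun M => \sum_(1 <= a < M) g a : R[i]^o) @ \oo --> (l : R[i]^o)) /\
    (forall M, (0 < M)%N -> cabs (l - \sum_(1 <= a < M) g a) <= 2 * C / M%:R).
Proof.
move=> C0 hg.
have diff M n : (0 < M)%N -> (M <= n)%N ->
    cabs (\sum_(1 <= a < n) g a - \sum_(1 <= a < M) g a) <= 2 * C / M%:R.
  move=> M0 Mn; rewrite (@big_cat_nat _ _ _ M 1 n) //= addrAC subrr add0r.
  exact: sum_cabs_inv_sqr.
have [l hl] : exists l : R[i],
    (fun M => \sum_(1 <= a < M) g a : R[i]^o) @ \oo --> (l : R[i]^o).
  apply: cauchy_cvg_complex => e e0.
  have [M hM] := near_inv_nat (2 * C) e0.
  have [M0 MC] := hM _ (leqnn M).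
  by exists M => n Mn; rewrite (le_trans (diff _ _ M0 Mn)).
exists l; split=> // M M0.
apply/ler_addgt0Pr => e e0.
have [M1 hM1] := (cvg_cabsP _ _).2 hl _ e0.
pose n := maxn M M1.
have := cabsD (l - \sum_(1 <= a < n) g a) (\sum_(1 <= a < n) g a - \sum_(1 <= a < M) g a).
rewrite addrA subrK => /le_trans; apply.
rewrite addrC lerD ?diff ?leq_maxl //.
by rewrite cabsB hM1 // leq_maxr.
Qed.

End Modulus.

Arguments cabs : simpl never.

(** * Explicit bounds for [e2pi] and for its distance to 1 *)

Section Exponential.
Variable R : realType.
Implicit Types z w : R[i].

Lemma sin_mvt (x : R) : 0 < x -> exists2 c : R, 0 < c < x & sin x = cos c * x.
Proof.
move=> x0.
have hd (y : R) : y \in `]0, x[ -> is_derive y 1 (@sin R) (cos y).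
  by move=> _; exact: is_derive_sin.
have hc : {within `[0, x], continuous (@sin R)}.
  by apply: continuous_subspaceT => y; exact: continuous_sin.
have [c] := MVT x0 hd hc.
by rewrite in_itv /= sin0 !subr0 => cx ->; exists c.
Qed.

Lemma sin_le_id (x : R) : `|sin x| <= `|x|.
Proof.
wlog x0 : x / 0 < x => [H|].
  have [x0|x0|->] := ltrgt0P x; last by rewrite sin0 normr0.
  - by have := H _ x0; rewrite (gtr0_norm x0).
  - by have := H (- x); rewrite oppr_gt0 => /(_ x0); rewrite sinN !normrN (ltr0_norm x0).
have [c _ ->] := sin_mvt x0.
by rewrite normrM ler_piMl // cos_max.
Qed.

Lemma one_sub_cos_le (x : R) : 1 - cos x <= `|x|.
Proof.
have -> : 1 - cos x = 2 * sin (x / 2) ^+ 2.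
  have -> : cos x = cos ((x / 2) *+ 2) by congr cos; rewrite -mulr_natr divfK.
  by rewrite cos_mulr2n sin2cos2; ring.
have h1 := sin_le_id (x / 2).
have h2 := sin_max (x / 2).
rewrite -real_normK ?num_real // expr2 normrM in h1 *.
rewrite [`|2^-1|]ger0_norm ?invr_ge0 // in h1.
have := normr_ge0 (sin (x / 2)); nra.
Qed.

Lemma e2piD z w : e2pi (z + w) = e2pi z * e2pi w.
Proof.
rewrite /e2pi !raddfD /= !mulrDr opprD expRD rmorphM /= mulrACA; congr (_ * _).
by rewrite cosD sinD; apply/eqP; rewrite eq_complex /= eqxx /= addrC.
Qed.

Lemma e2pi0 : e2pi 0 = 1 :> R[i].
Proof. by rewrite /e2pi /= !mulr0 oppr0 expR0 cos0 sin0 mulr1. Qed.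

Lemma e2pi1 : e2pi 1 = 1 :> R[i].
Proof.
rewrite /e2pi /= mulr0 oppr0 expR0 mulr1.
by rewrite mulr_natl cos2pi sin2pi mulr1.
Qed.

Lemma e2piMn n z : e2pi (n%:R * z) = e2pi z ^+ n.
Proof.
elim: n => [|n IH]; first by rewrite mul0r e2pi0 expr0.
by rewrite -natr1 mulrDl mul1r e2piD IH exprSr.
Qed.

Lemma e2pi_nat n : e2pi n%:R = 1 :> R[i].
Proof. by rewrite -[n%:R]mulr1 e2piMn e2pi1 expr1n. Qed.

Lemma e2piN z : e2pi (- z) = (e2pi z)^-1.
Proof.
have h : e2pi (- z) * e2pi z = 1 by rewrite -e2piD addNr e2pi0.
have z0 : e2pi z != 0 by apply: contra_eq_neq h => ->; rewrite mulr0 eq_sym oner_neq0.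
by apply: (mulIf z0); rewrite h mulVf.
Qed.

Lemma e2pi_int (n : int) : e2pi n%:~R = 1 :> R[i].
Proof.
case: n => n; first by rewrite -pmulrn e2pi_nat.
by rewrite NegzE mulrNz -pmulrn e2piN e2pi_nat invr1.
Qed.

Lemma e2piDint z (n : int) : e2pi (z + n%:~R) = e2pi z.
Proof. by rewrite e2piD e2pi_int mulr1. Qed.

Lemma cabs_e2pi z : cabs (e2pi z) = expR (- (2 * pi * complex.Im z)).
Proof.
rewrite /e2pi cabsM cabs_real ger0_norm ?expR_ge0 //.
by rewrite /cabs /= cos2Dsin2 sqrtr1 mulr1.
Qed.

Lemma cabs_e2pi_le1 z : 0 <= complex.Im z -> cabs (e2pi z) <= 1.
Proof.
by move=> h; rewrite cabs_e2pi -[leRHS]expR0 ler_expR oppr_le0 !mulr_ge0 // pi_ge0.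
Qed.

(** Radius and angle are separated: [r u - 1 = r (u - 1) + (r - 1)] with [|u| = 1] and [r <= 1]. *)
Lemma cabs_e2pi_sub1 z : 0 <= complex.Im z ->
  cabs (e2pi z - 1) <= 4 * pi * (`|complex.Re z| + complex.Im z).
Proof.
case: z => x y y0; rewrite -[complex.Im _]/y -[complex.Re _]/x; rewrite -[complex.Im _]/y in y0.
have -> : e2pi (x +i* y) - 1 =
    (expR (- (2 * pi * y)))%:C * ((cos (2 * pi * x) +i* sin (2 * pi * x)) - 1)
    + (expR (- (2 * pi * y)) - 1)%:C.
  by rewrite /e2pi /= rmorphB /=; ring.
have py := pi_ge0 R.
have s0 : 0 <= 2 * pi * y by rewrite !mulr_ge0.
have e1 : expR (- (2 * pi * y)) <= 1 by rewrite -[leRHS]expR0 ler_expR oppr_le0.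
have e2 := expR_ge1Dx (- (2 * pi * y)).
have e3 := expR_ge0 (- (2 * pi * y)).
rewrite (le_trans (cabsD _ _)) // [leRHS]mulrDr lerD //.
  rewrite cabsM cabs_real (ger0_norm e3).
  apply: (@le_trans _ _ (`|cos (2 * pi * x) - 1| + `|sin (2 * pi * x)|)).
    rewrite -[leRHS]mul1r ler_pM ?cabs_ge0 //.
    by rewrite (le_trans (cabs_le_ReIm _)) //= subr0.
  have h1 := one_sub_cos_le (2 * pi * x).
  have h2 := sin_le_id (2 * pi * x).
  rewrite !normrM ger0_norm // (ger0_norm py) in h1 h2.
  rewrite distrC ger0_norm ?subr_ge0 ?cos_le1 //; lra.
rewrite cabs_real distrC ger0_norm ?subr_ge0 //.
have : 0 <= pi * y by rewrite mulr_ge0.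
lra.
Qed.

(** By the mean value theorem [sin x = x cos c] with [0 < c < x]. As [x < 2], [cos c ^ 2 >= cos x ^
    2 = 1 - x ^ 2 cos c ^ 2 >= 1 - 4 cos c ^ 2], so [cos c ^ 2 >= 1 / 5]. *)
Lemma sin_sqr_ge (x : R) : `|x| <= pi / 2 -> x ^+ 2 / 5 <= sin x ^+ 2.
Proof.
wlog x0 : x / 0 < x => [H|].
  have [x0|x0|->] := ltrgt0P x; last by rewrite expr0n mul0r sqr_ge0.
  - by have := H _ x0; rewrite (gtr0_norm x0).
  - have := H (- x); rewrite oppr_gt0 => /(_ x0).
    by rewrite sinN !sqrrN normrN (ltr0_norm x0).
rewrite (gtr0_norm x0) => xp.
have [c /andP[c0 cx] sx] := sin_mvt x0.
have x2 : x < 2 by rewrite (le_lt_trans xp) ?pihalf_lt2.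
have pp := pi_gt0 R.
have cc : cos x <= cos c.
  by rewrite ltW // ltr_cos // in_itv /=; apply/andP; split; lra.
have cx0 : 0 <= cos x by apply: cos_ge0_pihalf; apply/andP; split; lra.
have c1 := cos_le1 c.
have : cos x ^+ 2 <= cos c ^+ 2 by rewrite ler_pXn2r // nnegrE ?(le_trans cx0).
rewrite cos2sin2 sx exprMn => h.
have x4 : x ^+ 2 <= 4 by nra.
have k5 : 1 <= cos c ^+ 2 * 5.
  have := ler_wpM2l (sqr_ge0 (cos c)) x4; lra.
by rewrite ler_pdivrMr // mulrAC ler_peMl // sqr_ge0.
Qed.

(** This bound is uniform in the imaginary part, as a tangential approach to the real line requires.
    With radius [r], cosine [c] and sine [s], the squared modulus is [s ^ 2 + (r - c) ^ 2]; it is at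
    least 1 if [c <= 0], and otherwise [s ^ 2] alone suffices. *)
Lemma cabs_sub_e2pi_ge z (j : int) : `|complex.Re z - j%:~R| <= 2^-1 ->
  `|complex.Re z - j%:~R| <= cabs (1 - e2pi z).
Proof.
have -> : complex.Re z - j%:~R = complex.Re (z - j%:~R).
  by rewrite raddfB /= -[j%:~R in RHS](rmorph_int (real_complex R)).
have -> : e2pi z = e2pi (z - j%:~R) by rewrite -(e2piDint (z - j%:~R) j) subrK.
move: (z - j%:~R) => {z j} [t y] /= ht.
rewrite -(@ler_pXn2r _ 2) ?nnegrE ?normr_ge0 ?cabs_ge0 //.
rewrite real_normK ?num_real //. rewrite cabs_sqr /e2pi /= !mul0r subr0 addr0 add0r sqrrN.
set r := expR _; set c := cos _; set s := sin _.
have r0 : 0 < r by exact: expR_gt0.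
have cs : c ^+ 2 + s ^+ 2 = 1 by exact: cos2Dsin2.
have pp := pi_ge2 R.
have [c0|c0] := lerP c 0.
  have : t ^+ 2 <= 1.
    rewrite -[1](expr1n _ 2) -real_normK ?num_real // ler_pXn2r ?nnegrE //.
    by rewrite (le_trans ht) // invf_le1 // ler1n.
  have := sqr_ge0 s; nra.
(* Since [|2 pi t| <= pi], a positive cosine leaves only the angles on which [sin_sqr_ge]
   applies. *)
have ht' : `|2 * pi * t| <= pi / 2.
  rewrite leNgt; apply/negP => h.
  have : c <= 0; last by rewrite leNgt c0.
  rewrite /c -cos_norm.
  have h2 : `|2 * pi * t| <= pi.
    rewrite !normrM ger0_norm // (ger0_norm (pi_ge0 R)).
    have := ler_wpM2l (pi_ge0 R) ht; lra.
  rewrite -cos_pihalf ltW // ltr_cos // in_itv /=; apply/andP; split; lra.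
have := sin_sqr_ge ht'; rewrite -/s => hs.
have h1 : t ^+ 2 <= s ^+ 2.
  apply: le_trans hs; rewrite ler_pdivlMr // exprMn mulrC.
  rewrite ler_wpM2r ?sqr_ge0 //; nra.
apply: (le_trans h1).
have := sqr_ge0 (r - c); nra.
Qed.

Lemma cabs_sub_e2pi_ge_exp z : 0 <= complex.Im z ->
  1 - expR (- (2 * pi * complex.Im z)) <= cabs (1 - e2pi z).
Proof.
move=> z0; rewrite -cabs_e2pi lerBlDr -cabs1.
by rewrite (le_trans _ (cabsD _ _)) // subrK.
Qed.

Lemma one_sub_e2pi_neq0 z : 0 < complex.Im z -> 1 - e2pi z != 0.
Proof.
move=> z0; apply/negP => /eqP h; have := cabs_sub_e2pi_ge_exp (ltW z0).
rewrite h cabs0 leNgt subr_gt0 -[ltRHS]expR0 ltr_expR oppr_lt0 !mulr_gt0 //.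
exact: pi_gt0.
Qed.

End Exponential.

(** * Dirichlet characters, roots of unity and Gauss sums *)

Section Characters.
Variables (R : realType) (q : nat).
Hypothesis q_gt1 : (1 < q)%N.

Let q_gt0 : (0 < q)%N. Proof. exact: ltnW. Qed.

Lemma dirichlet_congr (chi : int -> R[i]) (m n : int) : dirichlet_character q chi ->
  (m = n %[mod q%:Z])%Z -> chi m = chi n.
Proof.
move=> [_ _ hp _] hmn.
have hk (k : nat) x : chi (x + k%:Z * q%:Z) = chi x.
  elim: k => [|k IH]; first by rewrite mul0r addr0.
  by rewrite -addn1 PoszD mulrDl mul1r addrA hp IH.
have hz (k : int) x : chi (x + k * q%:Z) = chi x.
  case: k => k; first exact: hk.
  by rewrite NegzE -[RHS](hk k.+1) -(hk k.+1 (x + _)) mulNr subrK hk.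
rewrite (divz_eq m q%:Z) (divz_eq n q%:Z) hmn.
by rewrite ![_ * _ + _]addrC !hz.
Qed.

Lemma dirichlet_mod (chi : int -> R[i]) (n : nat) : dirichlet_character q chi ->
  chi (n %% q)%N%:Z = chi n%:Z.
Proof. by move=> hc; apply: dirichlet_congr hc _; rewrite -modz_nat modz_mod. Qed.

Lemma dirichlet_repr (n : int) :
  exists2 k : nat, (0 < k)%N & (k%:Z = n %[mod q%:Z])%Z.
Proof.
have q0 : q%:Z != 0 by rewrite eqz_nat -lt0n.
exists (`|(n %% q%:Z)%Z| + q)%N; first by rewrite addn_gt0 q_gt0 orbT.
by rewrite PoszD gez0_abs ?modz_ge0 // modzDr modz_mod.
Qed.

Lemma dirichlet0 (chi : int -> R[i]) : dirichlet_character q chi -> chi 0 = 0.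
Proof.
move=> [_ _ _ hu]; apply/eqP; rewrite -[_ == _]negbK hu coprimezE /= /coprime gcd0n.
by rewrite gtn_eqF.
Qed.

(** On units, Euler's theorem gives [chi n ^ totient q = 1], hence modulus 1; elsewhere the value is
    0. *)
Lemma dirichlet_le1 (chi : int -> R[i]) n : dirichlet_character q chi ->
  cabs (chi n) <= 1.
Proof.
move=> hc; have [k k0 hk] := dirichlet_repr n.
rewrite -(dirichlet_congr hc hk).
have [h1 hM _ hu] := hc.
have [->|nz] := eqVneq (chi k%:Z) 0; first by rewrite cabs0.
have co : coprime k q by have := hu k%:Z; rewrite nz coprimezE.
have hX j : chi (k ^ j)%N%:Z = chi k%:Z ^+ j.
  by elim: j => [|j IH]; rewrite ?h1 // expnS PoszM hM IH exprS.
have : chi k%:Z ^+ totient q = 1.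
  rewrite -hX -(dirichlet_mod _ hc) (Euler_exp_totient co) (dirichlet_mod _ hc).
  exact: h1.
move/(congr1 (@cabs R)); rewrite cabsX cabs1 => /eqP.
by rewrite pexpr_eq1 ?cabs_ge0 ?totient_gt0 // => /eqP ->.
Qed.

(** The values at [n] and at an inverse of [n] modulo [q] have product 1 and moduli at most 1, so
    both lie on the unit circle. *)
Lemma dirichlet_mulconj (chi : int -> R[i]) n : dirichlet_character q chi ->
  coprimez n q%:Z -> chi n * conj_character chi n = 1.
Proof.
move=> hc co.
have hcop := hc; have [h1 hM _ hu] := hcop.
have [k k0 hk] : exists2 m : int, True & (n * m = 1 %[mod q%:Z])%Z.
  have [[u v] /= huv] := coprimezP _ _ co.
  exists u => //; by rewrite mulrC -huv addrC modzMDl.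
have nm : chi n * chi k = 1 by rewrite -hM (dirichlet_congr hc hk).
have a1 := dirichlet_le1 n hc; have a2 := dirichlet_le1 k hc.
have a3 : cabs (chi n) * cabs (chi k) = 1 by rewrite -cabsM nm cabs1.
have a4 : cabs (chi n) = 1.
  have := cabs_ge0 (chi n); have := cabs_ge0 (chi k); nra.
by rewrite /conj_character -sqr_normc normE a4 expr1n.
Qed.

Lemma conj_dirichlet (chi : int -> R[i]) : dirichlet_character q chi ->
  dirichlet_character q (conj_character chi).
Proof.
move=> [h1 hM hp hu]; rewrite /conj_character; split=> [|m n|n|n].
- by rewrite h1 conjc1.
- by rewrite hM rmorphM.
- by rewrite hp.
- by rewrite conjc_eq0 hu.
Qed.

Lemma sum_ord_coprime_reindex (V : nmodType) (G : nat -> V) n : coprime n q ->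
  (forall c, G (c %% q)%N = G c) -> \sum_(b < q) G (n * b)%N = \sum_(b < q) G b.
Proof.
move=> co hG.
pose f (b : 'I_q) : 'I_q := Ordinal (ltn_pmod (n * b) q_gt0).
have finj : injective f.
  move=> b c /(congr1 val) /= /eqP h; apply: val_inj => /=.
  have [bc|/ltnW bc] := leqP b c.
    move: h; rewrite eq_sym eqn_mod_dvd ?leq_mul2l ?bc ?orbT // -mulnBr.
    rewrite Gauss_dvdr 1?coprime_sym // => hd.
    have [h0|/dvdn_leq/(_ hd)] := posnP (c - b); first by lia.
    by have := ltn_ord c; lia.
  move: h; rewrite eqn_mod_dvd ?leq_mul2l ?bc ?orbT // -mulnBr.
  rewrite Gauss_dvdr 1?coprime_sym // => hd.
  have [h0|/dvdn_leq/(_ hd)] := posnP (b - c); first by lia.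
  by have := ltn_ord b; lia.
rewrite [RHS](reindex_inj finj) /=.
by apply: eq_bigr => b _; rewrite hG.
Qed.

Let zeta : R[i] := e2pi q%:R^-1.

Lemma e2pi_div_exp n : e2pi (n%:R / q%:R) = zeta ^+ n :> R[i].
Proof. exact: e2piMn. Qed.

Lemma e2pi_root_unity : zeta ^+ q = 1.
Proof. by rewrite -e2pi_div_exp divff ?e2pi1 // pnatr_eq0 -lt0n. Qed.

(** After reduction to [0 < k < q], the number [k / q] is at positive distance at most 1/2 from 0 or
    from 1, and [cabs_sub_e2pi_ge] keeps its exponential away from 1. *)
Lemma e2pi_root_eq1 k : zeta ^+ k = 1 -> (q %| k)%N.
Proof.
rewrite -(expr_mod _ e2pi_root_unity) /dvdn; move: (ltn_pmod k q_gt0).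
move: (k %% q)%N => {}k kq; apply: contra_eqT; rewrite -lt0n => k0.
rewrite -e2pi_div_exp -[k%:R / _](_ : (k%:R / q%:R)%:C = _); last first.
  by rewrite fmorph_div !rmorph_nat.
set x := k%:R / q%:R.
have qR : 0 < q%:R :> R by rewrite ltr0n.
have x0 : 0 < x by rewrite divr_gt0 ?ltr0n.
have x1 : x < 1 by rewrite ltr_pdivrMr // mul1r ltr_nat.
have H (j : int) : `|x - j%:~R| <= 2^-1 -> 0 < `|x - j%:~R| -> e2pi x%:C != 1.
  move=> h h0; have := @cabs_sub_e2pi_ge R x%:C j h => /(lt_le_trans h0).
  by apply: contraTneq => ->; rewrite subrr cabs0 ltxx.
have [xh|xh] := lerP x 2^-1.
  by apply: (H 0); rewrite subr0 gtr0_norm.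
have : x - 1 < 0 by lra.
by move=> x1'; apply: (H 1); rewrite ltr0_norm //; lra.
Qed.

Lemma sum_root_unity k : ~~ (q %| k)%N -> \sum_(n < q) (zeta ^+ k) ^+ n = 0.
Proof.
move=> qk; have k1 : zeta ^+ k - 1 != 0.
  by rewrite subr_eq0; apply: contraNneq qk => /e2pi_root_eq1.
apply: (mulfI k1); rewrite mulr0 -subrX1 exprAC e2pi_root_unity expr1n subrr //.
Qed.

(** For [n] prime to [q], substitute [n b] for [b] in the Gauss sum. Otherwise let
    [g = gcd (n, q) > 1]: primitivity gives a unit [u = 1] modulo [q / g] with [chi u <> 1].
    Replacing [b] by [u b] preserves [n b] modulo [q] but scales the sum by the conjugate of
    [chi u], so the sum is 0. *)
Lemma gauss_sum_twist (chi : int -> R[i]) (n : nat) : primitive_character q chi ->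
  \sum_(b < q) conj_character chi b%:Z * e2pi ((n * b)%N%:R / q%:R)
  = chi n%:Z * gauss_sum q (conj_character chi).
Proof.
move=> [hc hprim].
have hcj := conj_dirichlet hc.
have [h1 hM hp hu] := hcj.
have hG m c : conj_character chi (c %% q)%N%:Z * zeta ^+ (m * (c %% q))%N =
              conj_character chi c%:Z * zeta ^+ (m * c)%N.
  congr (_ * _); first exact: dirichlet_mod.
  by rewrite -[LHS](expr_mod _ e2pi_root_unity) modnMmr (expr_mod _ e2pi_root_unity).
under eq_bigr do rewrite e2pi_div_exp.
rewrite /gauss_sum; under [in RHS]eq_bigr do rewrite e2pi_div_exp.
have [co|nco] := boolP (coprime n q).
  rewrite -(@sum_ord_coprime_reindex _
    (fun b => conj_character chi b%:Z * zeta ^+ b) _ co); last first.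
    by move=> c; have := hG 1%N c; rewrite !mul1n.
  rewrite mulr_sumr; apply: eq_bigr => b _.
  by rewrite PoszM hM !mulrA dirichlet_mulconj ?mul1r // coprimezE.
have -> : chi n%:Z = 0.
  by have [_ _ _ hu'] := hc; apply/eqP; rewrite -[_ == _]negbK hu' coprimezE.
rewrite mul0r.
pose g := gcdn n q.
have g0 : (0 < g)%N by rewrite gcdn_gt0 q_gt0 orbT.
have gq : (g %| q)%N by exact: dvdn_gcdr.
have g1 : (1 < g)%N by rewrite ltn_neqAle g0 andbT eq_sym.
pose d := (q %/ g)%N.
have dg : (d * g)%N = q by exact: divnK.
have dq : (d %| q)%N by rewrite -dg dvdn_mulr.
have dltq : (d < q)%N by rewrite ltn_Pdiv.
have [u [cu ud chiu]] : exists u : int,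
    [/\ coprimez u q%:Z, (u = 1 %[mod d%:Z])%Z & chi u <> 1].
  have := hprim _ dq dltq; rewrite -existsNE => -[u].
  by move=> /not_implyP[cu /not_implyP[ud chiu]]; exists u.
have [k k0 hk] := dirichlet_repr u.
have kd : (k%:Z = 1 %[mod d%:Z])%Z.
  rewrite -ud; apply/eqP; rewrite eqz_mod_dvd.
  apply: (@dvdz_trans q%:Z); first by rewrite dvdzE.
  by rewrite -eqz_mod_dvd; apply/eqP.
have ck : coprime k q.
  by have [_ _ _ hu'] := hc; have := hu' u; rewrite cu -(dirichlet_congr hc hk) hu' coprimezE.
set S := LHS.
have : S = conj_character chi k%:Z * S.
  rewrite {1}/S -(@sum_ord_coprime_reindex _ _ _ ck (hG n)) mulr_sumr.
  apply: eq_bigr => b _; rewrite PoszM hM mulrA; congr (_ * _).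
  rewrite -[LHS](expr_mod _ e2pi_root_unity) -[RHS](expr_mod _ e2pi_root_unity).
  congr (_ ^+ _); apply/eqP.
  have [m hm] : exists m, k = (m * d).+1.
    move/eqP: kd; rewrite eqz_mod_dvd -[1]/(Posz 1) subzn // dvdzE /= => /dvdnP[m hm].
    by exists m; rewrite -hm subn1 prednK.
  have [n' hn'] : exists n', n = (n' * g)%N by apply/dvdnP; exact: dvdn_gcdl.
  have -> : (n * (k * b))%N = (m * n' * b * q + n * b)%N by move: (nat_of_ord b) => c; rewrite hm hn' -dg; ring.
  by rewrite modnMDl.
move/eqP; rewrite -subr_eq0 -[X in X - _]mul1r -mulrBl mulf_eq0 subr_eq0.
case/orP=> [/eqP e|/eqP //].
case: chiu; rewrite -(dirichlet_congr hc hk).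
have e' : (chi k)^*%C = 1 by rewrite [RHS]e.
by rewrite -[LHS]conjcK e' conjc1.
Qed.

(** Fourier inversion: if the Gauss sum vanished, all its twists would, and with them the Fourier
    transform of [conj_character chi]; its coefficient at 1 would then be 0 instead of 1. *)
Lemma gauss_sum_neq0 (chi : int -> R[i]) : primitive_character q chi ->
  gauss_sum q (conj_character chi) != 0.
Proof.
move=> hc; apply/negP => /eqP t0.
have [h1 _ _ _] := conj_dirichlet hc.1.
have : \sum_(n < q) (\sum_(b < q) conj_character chi b%:Z * e2pi ((n * b)%N%:R / q%:R))
         * zeta ^+ (n * q.-1)%N = 0.
  by apply: big1 => n _; rewrite gauss_sum_twist // t0 mulr0 mul0r.
under eq_bigr do rewrite mulr_suml.
rewrite exchange_big /=.
(* The weight [zeta ^ (n (q - 1))] is [zeta ^ (- n)], so the sum over [n] selects [b = 1]. *)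
rewrite (bigD1 (Ordinal q_gt1)) //= [X in _ + X]big1 => [|b b1]; last first.
  under eq_bigr do rewrite e2pi_div_exp -mulrA -exprD -mulnDr mulnC exprM.
  rewrite -mulr_sumr sum_root_unity ?mulr0 //.
  apply/negP => /dvdnP[k hk].
  have b1' : b <> 1%N :> nat by move=> e; case/eqP: b1; exact: val_inj.
  have := ltn_ord b; move: (nat_of_ord b) b1' hk (prednK q_gt0) q_gt1 => c.
  by clear; case: k => [|[|k]]; rewrite ?mulSn; lia.
under eq_bigr do
  rewrite e2pi_div_exp h1 mul1r -exprD -mulnDr add1n prednK // mulnC exprM
          e2pi_root_unity expr1n.
rewrite addr0 sumr_const card_ord => /eqP.
by rewrite pnatr_eq0 gtn_eqF.
Qed.

End Characters.

(** * The Lambert kernel: its size and the convergence of its series *)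

Section LambertKernel.
Variables (R : realType) (q : nat) (chi : int -> R[i]).
Implicit Types (w : R[i]).
Hypotheses (q_gt1 : (1 < q)%N) (chi_dirichlet : dirichlet_character q chi).

(* The closed form of \sum_(b >= 1) chi b * e2pi (b w). *)
Definition lambert_kernel (w : R[i]) : R[i] :=
  (\sum_(b < q) chi b%:Z * e2pi (b%:R * w)) / (1 - e2pi (q%:R * w)).

Let q_gt0 : (0 < q)%N. Proof. exact: ltnW. Qed.

Lemma complex_ImMn n (w : R[i]) : complex.Im (n%:R * w) = n%:R * complex.Im w.
Proof. by rewrite !mulr_natl raddfMn. Qed.

Lemma complex_ReMn n (w : R[i]) : complex.Re (n%:R * w) = n%:R * complex.Re w.
Proof. by rewrite !mulr_natl raddfMn. Qed.

Lemma kernel_den_neq0 w : 0 < complex.Im w -> 1 - e2pi (q%:R * w) != 0.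
Proof. by move=> w0; rewrite one_sub_e2pi_neq0 // complex_ImMn mulr_gt0 ?ltr0n. Qed.

Lemma cabs_kernel_le_den w : 0 < complex.Im w ->
  cabs (lambert_kernel w) <= q%:R / cabs (1 - e2pi (q%:R * w)).
Proof.
move=> w0; rewrite cabsM cabsV ler_wpM2r ?invr_ge0 ?cabs_ge0 //.
rewrite (le_trans (cabs_sum _ _ _)) //.
rewrite (@le_trans _ _ (\sum_(b < q) (1 : R))) //; last by rewrite sumr_const card_ord.
apply: ler_sum => b _; rewrite cabsM mulr_ile1 ?cabs_ge0 //.
  exact: dirichlet_le1 q_gt1 _ _ chi_dirichlet.
by rewrite cabs_e2pi_le1 // complex_ImMn mulr_ge0 // ltW.
Qed.

(** The term [b = 0] vanishes, so with [s = 2 pi y] and [r = exp (- s)] the numerator is at most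
    [q r], while the denominator is at least [1 - r]. From [1 + s <= exp s] follows
    [r / (1 - r) <= 1 / s]. *)
Lemma cabs_kernel_le w : 0 < complex.Im w ->
  cabs (lambert_kernel w) <= q%:R / complex.Im w.
Proof.
move=> w0; set y := complex.Im w in w0 *.
pose s := 2 * pi * y.
have sy : y <= s by have := pi_ge2 R; rewrite /s; nra.
have s0 : 0 < s by exact: lt_le_trans sy.
pose r := expR (- s).
have r0 : 0 < r by exact: expR_gt0.
have r1 : r < 1 by rewrite -expR0 ltr_expR oppr_lt0.
have q1 : 1 <= q%:R :> R by rewrite ler1n.
have den : 1 - r <= cabs (1 - e2pi (q%:R * w)).
  have := @cabs_sub_e2pi_ge_exp R (q%:R * w).
  rewrite complex_ImMn => /(_ (mulr_ge0 (ler0n _ _) (ltW w0))).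
  apply: le_trans; rewrite lerD2l lerN2 ler_expR lerN2.
  by rewrite -/y mulrCA -/s ler_peMl // ltW.
have num : cabs (\sum_(b < q) chi b%:Z * e2pi (b%:R * w)) <= q%:R * r.
  rewrite (le_trans (cabs_sum _ _ _)) //.
  rewrite (@le_trans _ _ (\sum_(b < q) r)) //; last first.
    by rewrite sumr_const card_ord mulr_natl.
  apply: ler_sum => b _.
  have [b0|b0] := posnP b; first by rewrite b0 (dirichlet0 q_gt1) // mul0r cabs0 ltW.
  rewrite cabsM -[leRHS]mul1r ler_pM ?cabs_ge0 ?(dirichlet_le1 q_gt1) //.
  rewrite cabs_e2pi complex_ImMn ler_expR lerN2 -/y mulrCA -/s ler_peMl ?(ltW s0) //.
  by rewrite ler1n.
have rs : r * s <= 1 - r.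
  have := expR_ge1Dx s.
  have rr : r * expR s = 1 by rewrite /r expRN mulVf // gt_eqF ?expR_gt0.
  by move/(ler_wpM2l (ltW r0)); rewrite rr; lra.
rewrite cabsM cabsV.
apply: (@le_trans _ _ (q%:R * r / (1 - r))).
  rewrite ler_pM ?cabs_ge0 ?invr_ge0 ?cabs_ge0 // lef_pV2 ?posrE ?subr_gt0 //.
  by rewrite (lt_le_trans _ den) // subr_gt0.
rewrite -mulrA ler_wpM2l // ler_pdivrMr ?subr_gt0 // ler_pdivlMl //.
apply: le_trans rs; rewrite mulrC ler_wpM2l // ltW //.
Qed.

(** Shifting [b] by [q] multiplies a term by [e2pi (q w)], so after multiplication by
    [1 - e2pi (q w)] the error telescopes to [q] consecutive terms. Only a lower bound [y] of the
    imaginary part enters, which lets a single [r] serve all multiples [a z]. *)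
Lemma kernel_partial_sum w (y r : R) m : r = expR (- (2 * pi * y)) ->
  0 < y -> y <= complex.Im w ->
  cabs (\sum_(1 <= b < m.+1) chi b%:Z * e2pi (b%:R * w) - lambert_kernel w)
    <= q%:R * r ^+ m.+1 / (1 - r).
Proof.
move=> re y0 yw.
have w0 : 0 < complex.Im w by exact: lt_le_trans yw.
have py : 0 < 2 * pi * y by rewrite !mulr_gt0 // pi_gt0.
have r0 : 0 < r by rewrite re expR_gt0.
have r1 : r < 1 by rewrite re -[ltRHS]expR0 ltr_expR oppr_lt0.
pose F b := chi b%:Z * e2pi (b%:R * w).
have F0 : F 0%N = 0 by rewrite /F (dirichlet0 q_gt1) // mul0r.
have Fq b : F (b + q)%N = e2pi (q%:R * w) * F b.
  rewrite /F PoszD; have [_ _ -> _] := chi_dirichlet.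
  by rewrite natrD mulrDl e2piD; ring.
set B := \sum_(1 <= b < m.+1) _.
have -> : B = \sum_(0 <= b < m.+1) F b by rewrite big_ltn // F0 add0r.
set B' := \sum_(0 <= b < m.+1) F b.
have Er : lambert_kernel w * (1 - e2pi (q%:R * w)) = \sum_(0 <= b < q) F b.
  by rewrite divfK ?kernel_den_neq0 // big_mkord.
have ei : B' - lambert_kernel w =
    - (\sum_(m.+1 <= b < m.+1 + q) F b) / (1 - e2pi (q%:R * w)).
  apply: (mulIf (kernel_den_neq0 w0)); rewrite divfK ?kernel_den_neq0 //.
  rewrite mulrBl Er mulrBr mulr1.
  have e1 : \sum_(0 <= b < m.+1 + q) F b = B' + \sum_(m.+1 <= b < m.+1 + q) F b.
    by rewrite (@big_cat_nat _ _ _ m.+1) // leq_addr.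
  have e2 : \sum_(0 <= b < m.+1 + q) F b = \sum_(0 <= b < q) F b + e2pi (q%:R * w) * B'.
    rewrite (@big_cat_nat _ _ _ q) ?leq_addl //=; congr (_ + _).
    rewrite -{1}[q]add0n big_addn addnK mulr_sumr.
    by apply: eq_bigr => b _; rewrite Fq.
  have -> : \sum_(m.+1 <= b < m.+1 + q) F b =
            \sum_(0 <= b < q) F b + e2pi (q%:R * w) * B' - B' by rewrite -e2 e1 addrC addKr.
  ring.
rewrite ei cabsM cabsN cabsV.
have den : 1 - r <= cabs (1 - e2pi (q%:R * w)).
  have := @cabs_sub_e2pi_ge_exp R (q%:R * w).
  rewrite complex_ImMn => /(_ (mulr_ge0 (ler0n _ _) (ltW w0))).
  apply: le_trans; rewrite lerD2l lerN2 re ler_expR lerN2.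
  rewrite ler_wpM2l ?mulr_ge0 ?pi_ge0 // (le_trans yw) // ler_peMl ?ler1n //.
  exact: ltW.
rewrite ler_pM ?cabs_ge0 ?invr_ge0 ?cabs_ge0 //; last first.
  rewrite lef_pV2 ?posrE ?subr_gt0 //.
  by rewrite (lt_le_trans _ den) // subr_gt0.
rewrite (le_trans (cabs_sum _ _ _)) //.
rewrite (@le_trans _ _ (\sum_(m.+1 <= b < m.+1 + q) r ^+ m.+1)) //; last first.
  by rewrite sumr_const_nat addKn mulr_natl.
apply: ler_sum_nat => b /andP[mb _].
rewrite cabsM -[leRHS]mul1r ler_pM ?cabs_ge0 ?(dirichlet_le1 q_gt1) //.
rewrite e2piMn cabsX.
apply: (@le_trans _ _ (r ^+ b)).
  rewrite ler_pXn2r ?nnegrE ?cabs_ge0 ?(ltW r0) //; last by lia.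
  by rewrite cabs_e2pi re ler_expR lerN2 ler_wpM2l ?mulr_ge0 ?pi_ge0.
by rewrite ler_wiXn2l // ltW.
Qed.

End LambertKernel.

(** * The Eichler series regrouped by its first factor *)

Lemma sum_divisors (V : nmodType) (F : nat -> nat -> V) m :
  \sum_(1 <= n < m) \sum_(a <- divisors n) F a (n %/ a)%N =
  \sum_(1 <= a < m) \sum_(1 <= b < m | (a * b < m)%N) F a b.
Proof.
transitivity (\sum_(1 <= n < m) \sum_(1 <= a < m | (a %| n)%N) F a (n %/ a)%N).
  apply: eq_big_nat => n /andP[n1 nm]; rewrite -[RHS]big_filter.
  apply: perm_big; apply: uniq_perm.
  - exact: divisors_uniq.
  - by rewrite filter_uniq // iota_uniq.
  move=> a; rewrite -dvdn_divisors // mem_filter mem_index_iota.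
  have [an|] //= := boolP (a %| n)%N.
  by rewrite (dvdn_gt0 n1 an) (leq_ltn_trans (dvdn_leq n1 an) nm).
rewrite (exchange_big_dep_nat predT) //=.
apply: eq_big_nat => a /andP[a1 am].
rewrite -[LHS]big_filter -[RHS]big_filter.
rewrite (perm_big [seq (a * b)%N | b <- index_iota 1 m & (a * b < m)%N]); last first.
  apply: uniq_perm.
  - by rewrite filter_uniq // iota_uniq.
  - rewrite map_inj_uniq ?filter_uniq ?iota_uniq // => b c /eqP.
    by rewrite eqn_pmul2l // => /eqP.
  move=> n; rewrite mem_filter mem_index_iota; apply/idP/mapP.
    case/andP=> /dvdnP[b ->] /andP[n1 nm].
    exists b; last by rewrite mulnC.
    rewrite mem_filter mem_index_iota mulnC nm /=; nia.
  case=> b; rewrite mem_filter mem_index_iota => /and3P[h1 h2 h3] ->.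
  by rewrite dvdn_mulr // muln_gt0 a1 h2 h1.
by rewrite big_map; apply: eq_bigr => b _; rewrite mulKn.
Qed.

Section EichlerSeries.
Variables (R : realType) (q1 q2 : nat) (chi1 chi2 : int -> R[i]).
Hypotheses (q1_gt1 : (1 < q1)%N) (q2_gt1 : (1 < q2)%N).
Hypotheses (chi1_dirichlet : dirichlet_character q1 chi1)
  (chi2_dirichlet : dirichlet_character q2 chi2).

Let chi2c_dirichlet : dirichlet_character q2 (conj_character chi2).
Proof. exact: conj_dirichlet. Qed.

Definition lambert_term (z : R[i]) (a : nat) : R[i] :=
  chi1 a%:Z / a%:R * lambert_kernel q2 (conj_character chi2) (a%:R * z).

Lemma cabs_lambert_term z a : (0 < a)%N ->
  cabs (lambert_term z a) <=
    a%:R^-1 * cabs (lambert_kernel q2 (conj_character chi2) (a%:R * z)).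
Proof.
move=> a0; rewrite /lambert_term 2!cabsM cabsV cabs_nat ler_wpM2r ?cabs_ge0 //.
by rewrite ler_piMl ?invr_ge0 ?(dirichlet_le1 q1_gt1).
Qed.

Lemma cabs_lambert_term_le z a : 0 < complex.Im z -> (0 < a)%N ->
  cabs (lambert_term z a) <= (q2%:R / complex.Im z) / a%:R ^+ 2.
Proof.
move=> z0 a0; rewrite (le_trans (cabs_lambert_term z a0)) //.
have aR : 0 < a%:R :> R by rewrite ltr0n.
have h : 0 < complex.Im (a%:R * z) by rewrite complex_ImMn mulr_gt0.
have := cabs_kernel_le q2_gt1 chi2c_dirichlet h; rewrite complex_ImMn => hk.
have ai : 0 <= a%:R^-1 :> R by rewrite invr_ge0 ltW.
apply: (le_trans (ler_wpM2l ai hk)).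
suff -> : a%:R^-1 * (q2%:R / (a%:R * complex.Im z)) =
          (q2%:R / complex.Im z) / a%:R ^+ 2 by [].
by field; rewrite !gt_eqF.
Qed.

(** With [t = m y / 3], the exponential is at most [exp (- t) ^ 3 <= t ^ (- 3)]; this is the origin
    of [27 = 3 ^ 3]. *)
Lemma expR_decay (y : R) m : 0 < y -> (0 < m)%N ->
  m%:R ^+ 2 * expR (- (2 * pi * y)) ^+ m <= (27 / y ^+ 3) / m%:R.
Proof.
move=> y0 m0; have mR : 0 < m%:R :> R by rewrite ltr0n.
rewrite -expRM_natl.
pose t := m%:R * y / 3.
have t0 : 0 < t by rewrite divr_gt0 ?mulr_gt0.
have h : expR (m%:R * - (2 * pi * y)) <= (t ^+ 3)^-1.
  apply: (@le_trans _ _ (expR (3%:R * - t))).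
    rewrite ler_expR /t; have := pi_ge2 R; have : 0 < m%:R * y by rewrite mulr_gt0.
    nra.
  rewrite expRM_natl expRN exprVn lef_pV2 ?posrE ?exprn_gt0 ?expR_gt0 //.
  rewrite ler_pXn2r ?nnegrE ?expR_ge0 ?(ltW t0) //.
  by rewrite (le_trans _ (expR_ge1Dx _)) // lerDr.
apply: (le_trans (ler_wpM2l (sqr_ge0 _) h)).
suff -> : m%:R ^+ 2 * (t ^+ 3)^-1 = (27 / y ^+ 3) / m%:R by [].
by rewrite /t; field; rewrite !gt_eqF.
Qed.

(** The partial sum runs over pairs with [a b < m]. Compared with full kernels for [a < m], it lacks
    the pairs in the square with [a b >= m], each of size at most [r ^ m], and the tails [b >= m] of
    the kernels. *)
Lemma eichler_partial_sum z r m : r = expR (- (2 * pi * complex.Im z)) ->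
  0 < complex.Im z -> (0 < m)%N ->
  cabs (\sum_(1 <= n < m)
    (\sum_(a <- divisors n) chi1 a%:Z * conj_character chi2 (n %/ a)%N%:Z / a%:R)
      * e2pi (n%:R * z) - \sum_(1 <= a < m) lambert_term z a)
    <= m%:R ^+ 2 * r ^+ m * (1 + q2%:R / (1 - r)).
Proof.
move=> re z0 m0.
have r0 : 0 < r by rewrite re expR_gt0.
have r1 : r < 1 by rewrite re -[ltRHS]expR0 ltr_expR oppr_lt0 !mulr_gt0 // pi_gt0.
pose T a b := chi1 a%:Z * conj_character chi2 b%:Z / a%:R * e2pi ((a * b)%N%:R * z).
have mR : 1 <= m%:R :> R by rewrite ler1n.
rewrite [X in X - _](_ : _ = \sum_(1 <= a < m) \sum_(1 <= b < m | (a * b < m)%N) T a b);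
    last first.
  rewrite -sum_divisors; apply: eq_big_nat => n /andP[n1 _].
  rewrite mulr_suml big_seq [RHS]big_seq; apply: eq_bigr => a.
  by rewrite -dvdn_divisors // => an; rewrite /T (mulnC a) divnK.
rewrite -sumrB (le_trans (cabs_sum _ _ _)) //.
apply: (@le_trans _ _ (\sum_(1 <= a < m) (m%:R * r ^+ m * (1 + q2%:R / (1 - r))))); last first.
  rewrite sumr_const_nat -[leLHS]mulr_natl expr2 -[m%:R * m%:R * _]mulrA -[leRHS]mulrA.
  rewrite ler_wpM2r ?ler_nat ?leq_subr //.
  by rewrite !mulr_ge0 ?addr_ge0 ?divr_ge0 ?subr_ge0 ?exprn_ge0 // ltW.
apply: ler_sum_nat => a /andP[a1 am].
have aR : 1 <= a%:R :> R by rewrite ler1n.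
have aV : a%:R^-1 <= 1 :> R by rewrite invf_le1 // (lt_le_trans _ aR).
pose B := \sum_(1 <= b < m) T a b.
have -> : \sum_(1 <= b < m | (a * b < m)%N) T a b - lambert_term z a =
    (B - lambert_term z a) - \sum_(1 <= b < m | ~~ (a * b < m)%N) T a b.
  by rewrite [B](bigID (fun b => (a * b < m)%N)) /=; ring.
rewrite (le_trans (cabsBD _ _)) // mulrDr mulr1 addrC lerD //.
  rewrite (le_trans (cabs_sum _ _ _)) //.
  rewrite (@le_trans _ _ (\sum_(1 <= b < m) r ^+ m)) //; last first.
    rewrite sumr_const_nat -[leLHS]mulr_natl ler_wpM2r ?ler_nat ?leq_subr //.
    by rewrite exprn_ge0 // ltW.
  rewrite big_mkcond ler_sum_nat //= => b /andP[b1 bm].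
  case: ifPn => [abm|_]; last by rewrite exprn_ge0 // ltW.
  rewrite -leqNgt in abm.
  rewrite /T 3!cabsM cabsV cabs_nat e2piMn cabsX cabs_e2pi -re.
  apply: (@le_trans _ _ (1 * r ^+ (a * b))); last by rewrite mul1r ler_wiXn2l // ltW.
  rewrite ler_wpM2r ?exprn_ge0 ?(ltW r0) //.
  have cc : cabs (chi1 a%:Z) * cabs (conj_character chi2 b%:Z) <= 1.
    rewrite mulr_ile1 ?cabs_ge0 //; first exact: dirichlet_le1 chi1_dirichlet.
    exact: dirichlet_le1 chi2c_dirichlet.
  by rewrite mulr_ile1 ?mulr_ge0 ?cabs_ge0 ?invr_ge0.
have -> : B - lambert_term z a = chi1 a%:Z / a%:R *
   (\sum_(1 <= b < m.-1.+1) conj_character chi2 b%:Z * e2pi (b%:R * (a%:R * z))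
    - lambert_kernel q2 (conj_character chi2) (a%:R * z)).
  rewrite prednK // mulrBr mulr_sumr; congr (_ - _); apply: eq_bigr => b _.
  by rewrite /T natrM [in RHS]mulrA [b%:R * a%:R]mulrC; ring.
have hy : complex.Im z <= complex.Im (a%:R * z) by rewrite complex_ImMn ler_peMl // ltW.
have := kernel_partial_sum q2_gt1 chi2c_dirichlet m.-1 re z0 hy.
rewrite prednK // => hk.
rewrite cabsM; apply: (@le_trans _ _ (1 * (q2%:R * r ^+ m / (1 - r)))).
  rewrite ler_pM ?cabs_ge0 // cabsM cabsV cabs_nat.
  rewrite mulr_ile1 ?cabs_ge0 ?invr_ge0 //.
  exact: dirichlet_le1 chi1_dirichlet.
have -> : m%:R * r ^+ m * (q2%:R / (1 - r)) = m%:R * (q2%:R * r ^+ m / (1 - r)) by ring.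
by rewrite ler_wpM2r // !mulr_ge0 ?invr_ge0 ?subr_ge0 ?exprn_ge0 // ltW.
Qed.

(** The sum of the kernels converges absolutely, and by the two preceding lemmas the partial sums of
    the Eichler series have the same limit. *)
Lemma eichler_series_lambert z M : 0 < complex.Im z -> (0 < M)%N ->
  cabs (eichler_series chi1 chi2 z - \sum_(1 <= a < M) lambert_term z a)
    <= 2 * (q2%:R / complex.Im z) / M%:R.
Proof.
move=> z0 M0.
pose C := q2%:R / complex.Im z.
have C0 : 0 <= C by rewrite divr_ge0 // ltW.
have [l [hl hb]] := cvg_inv_sqr_series C0 (fun a => cabs_lambert_term_le z0 (a := a)).
suff -> : eichler_series chi1 chi2 z = l by exact: hb.
apply: (@cvg_lim R[i]^o); first exact: norm_hausdorff.
apply/cvg_cabsP => e e0.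
have e2 : 0 < e / 2 by rewrite divr_gt0.
have [M1 h1] := (cvg_cabsP _ _).2 hl _ e2.
pose r := expR (- (2 * pi * complex.Im z)).
have r1 : r < 1 by rewrite -[ltRHS]expR0 ltr_expR oppr_lt0 !mulr_gt0 // pi_gt0.
pose D := 1 + q2%:R / (1 - r).
have D0 : 0 <= D by rewrite addr_ge0 // divr_ge0 // subr_ge0 ltW.
have [M2 h2] := near_inv_nat (27 / complex.Im z ^+ 3 * D) e2.
exists (maxn M1 M2) => m; rewrite geq_max => /andP[m1 m2].
have [m0 hm] := h2 _ m2.
rewrite -[X in cabs X](subrKA (\sum_(1 <= a < m) lambert_term z a)).
rewrite (le_trans (cabsD _ _)) // [leRHS](splitr e) lerD ?h1 //.
rewrite (le_trans (eichler_partial_sum (erefl r) z0 m0)) // (le_trans _ hm) //.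
by rewrite -/D [leRHS]mulrAC ler_wpM2r // expR_decay.
Qed.

End EichlerSeries.

(** * Calculus of limits of complex sequences *)

Section ComplexLimits.
Variable R : realType.
Implicit Types (u v : nat -> R[i]) (k l : R[i]).

(* Sealing the convergence statement keeps unification from unfolding it. *)
Variant ctends u l : Prop :=
  CTends of (u : nat -> R[i]^o) @ \oo --> (l : R[i]^o).

Lemma ctendsP u l :
  (forall e : R, 0 < e -> exists M, forall n, (M <= n)%N -> cabs (u n - l) <= e) <->
  ctends u l.
Proof. by split=> [/cvg_cabsP|[] /cvg_cabsP]. Qed.

Lemma ctends_cst l : ctends (fun=> l) l.
Proof. by split; exact: cvg_cst. Qed.

Lemma ctendsD u v l k : ctends u l -> ctends v k -> ctends (fun n => u n + v n) (l + k).
Proof. by move=> [hu] [hv]; split; exact: cvgD hu hv. Qed.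

Lemma ctendsB u v l k : ctends u l -> ctends v k -> ctends (fun n => u n - v n) (l - k).
Proof. by move=> [hu] [hv]; split; exact: cvgB hu hv. Qed.

Lemma ctendsM u v l k : ctends u l -> ctends v k -> ctends (fun n => u n * v n) (l * k).
Proof. by move=> [hu] [hv]; split; exact: (@cvgM R[i] _ _ _ _ _ _ _ hu hv). Qed.

Lemma ctends_mull1 u l : ctends u 1 -> ctends (fun n => l * u n) l.
Proof. by move=> hu; have := ctendsM (ctends_cst l) hu; rewrite mulr1. Qed.

Lemma ctendsV u l : l != 0 -> ctends u l -> ctends (fun n => (u n)^-1) l^-1.
Proof. by move=> l0 [hu]; split; exact: (@cvgV R[i] _ _ _ _ _ l0 hu). Qed.

Lemma ctendsX u l n : ctends u l -> ctends (fun j => u j ^+ n) (l ^+ n).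
Proof.
move=> h; elim: n => [|n IH]; first exact: ctends_cst.
rewrite exprS; under eq_fun do rewrite exprS.
exact: ctendsM.
Qed.

Lemma ctends_sum (I : Type) (r : seq I) (P : pred I) (F : I -> nat -> R[i]) (G : I -> R[i]) :
  (forall i, P i -> ctends (F i) (G i)) ->
  ctends (fun n => \sum_(i <- r | P i) F i n) (\sum_(i <- r | P i) G i).
Proof.
move=> h; elim: r => [|i r IH].
  by rewrite big_nil; under eq_fun do rewrite big_nil; exact: ctends_cst.
rewrite big_cons; under eq_fun do rewrite big_cons.
by case: ifP => Pi; [exact: ctendsD (h _ Pi) IH | exact: IH].
Qed.

Lemma ctends_unique u l k : ctends u l -> ctends u k -> l = k.
Proof. by move=> [hu] [hv]; apply: cvg_unique hu hv; exact: norm_hausdorff. Qed.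

End ComplexLimits.

(** * Termwise limits at the cusp [h / (q2 m)] *)

Section CuspAsymptotics.
Variables (R : realType) (q1 q2 : nat) (chi1 chi2 : int -> R[i]) (m h : nat).
Hypotheses (q1_gt1 : (1 < q1)%N) (q2_gt1 : (1 < q2)%N).
Hypotheses (chi1_dirichlet : dirichlet_character q1 chi1)
  (chi2_primitive : primitive_character q2 chi2).
Hypotheses (m_gt0 : (0 < m)%N) (hm_coprime : coprime h m).

Let x : R[i] := h%:R / (q2 * m)%N%:R.
Let chi2_dirichlet : dirichlet_character q2 chi2. Proof. by case: chi2_primitive. Qed.
Let chi2c_dirichlet : dirichlet_character q2 (conj_character chi2).
Proof. exact: conj_dirichlet. Qed.
Let q2_gt0 : (0 < q2)%N. Proof. exact: ltnW. Qed.
Let q2R : 0 < q2%:R :> R. Proof. by rewrite ltr0n. Qed.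
Let mR : 0 < m%:R :> R. Proof. by rewrite ltr0n. Qed.
Let q2C : q2%:R != 0 :> R[i]. Proof. by rewrite pnatr_eq0 -lt0n. Qed.
Let mC : m%:R != 0 :> R[i]. Proof. by rewrite pnatr_eq0 -lt0n. Qed.

Local Notation term := (lambert_term q2 chi1 chi2).
Local Notation kernel := (lambert_kernel q2 (conj_character chi2)).

Let tau := gauss_sum q2 (conj_character chi2).

(** If [m] divides [a], the point [a x] is a pole of the kernel, whose leading coefficient is a
    twisted Gauss sum; otherwise the kernel is regular there. *)
Definition term_limit (a : nat) : R[i] :=
  if (m %| a)%N then chi1 a%:Z / a%:R * (chi2 (a %/ m * h)%N%:Z * tau / a%:R) else 0.

Lemma e2pi_tends (zeta : nat -> R[i]) k :
  (forall n, 0 <= complex.Im (zeta n)) -> ctends zeta 0 ->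
  ctends (fun n => e2pi (k%:R * zeta n)) 1.
Proof.
move=> z0 hz; under eq_fun do rewrite e2piMn.
rewrite -[1](expr1n _ k); apply: ctendsX.
apply/ctendsP => e e0.
have e8 : 0 < e / (8 * pi) by rewrite divr_gt0 // mulr_gt0 // pi_gt0.
have [M hM] := (ctendsP _ _).2 hz _ e8.
exists M => n /hM; rewrite subr0 => hn.
rewrite (le_trans (cabs_e2pi_sub1 (z0 n))) //.
have := Re_le_cabs (zeta n); have := Im_le_cabs (zeta n).
rewrite [X in X <= _ -> _]ger0_norm // => h1 h2.
rewrite ler_pdivlMr ?mulr_gt0 ?pi_gt0 // in hn.
have pp := pi_gt0 R.
have h3 : `|complex.Re (zeta n)| + complex.Im (zeta n) <= 2 * cabs (zeta n) by lra.
have h4 : 0 <= 4 * pi :> R by rewrite mulr_ge0 ?pi_ge0.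
have := ler_wpM2l h4 h3; lra.
Qed.

(** If [m] divides [a], the denominator is [1 - e ^ a] with [e = e2pi (q2 zeta)]; the factor [1 - e]
    cancels and leaves a geometric sum tending to [a]. Otherwise the denominator tends to
    [1 - e2pi (a h / m)], nonzero because [h] is prime to [m], and the factor [1 - e] forces the
    limit 0. *)
Lemma term_tends (zeta : nat -> R[i]) a : (0 < a)%N ->
  (forall n, 0 < complex.Im (zeta n)) -> ctends zeta 0 ->
  ctends (fun n => (1 - e2pi (q2%:R * zeta n)) * term (x + zeta n) a) (term_limit a).
Proof.
move=> a0 z0 hz.
have z0' n : 0 <= complex.Im (zeta n) by exact: ltW.
have he k : ctends (fun n => e2pi (k%:R * zeta n)) 1 by exact: e2pi_tends.
pose P n := \sum_(b < q2) conj_character chi2 b%:Z * e2pi (b%:R * (a%:R * (x + zeta n))).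
have hP : ctends P (\sum_(b < q2) conj_character chi2 b%:Z * e2pi ((b * a)%N%:R * x)).
  apply: ctends_sum => b _; apply: ctendsM; first exact: ctends_cst.
  under eq_fun do rewrite mulrA -natrM mulrDr e2piD.
  exact: ctends_mull1.
have den n : 1 - e2pi (q2%:R * (a%:R * (x + zeta n))) =
    1 - e2pi ((a * h)%N%:R / m%:R) * e2pi ((q2 * a)%N%:R * zeta n).
  rewrite -e2piD; congr (1 - e2pi _).
  by rewrite /x !natrM; field; rewrite q2C mC.
have [ma|nma] := boolP (m %| a)%N.
  have hlim : ctends (fun n => chi1 a%:Z / a%:R *
      (P n / \sum_(i < a) e2pi (q2%:R * zeta n) ^+ i)) (term_limit a).
    rewrite /term_limit ma; apply: ctendsM; first exact: ctends_cst.
    apply: ctendsM; last first.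
      apply: ctendsV; first by rewrite pnatr_eq0 -lt0n.
      rewrite (_ : a%:R = \sum_(i < a) 1 ^+ i); last first.
        by under eq_bigr do rewrite expr1n; rewrite sumr_const card_ord.
      by apply: ctends_sum => i _; apply: ctendsX; exact: he.
    rewrite /tau -gauss_sum_twist //.
    have <- : \sum_(b < q2) conj_character chi2 b%:Z * e2pi ((b * a)%N%:R * x) =
       \sum_(b < q2) conj_character chi2 b%:Z * e2pi ((a %/ m * h * b)%N%:R / q2%:R) by
      apply: eq_bigr => b _; congr (_ * e2pi _); rewrite /x -{1}(divnK ma) !natrM;
      field; rewrite q2C mC.
    exact: hP.
  rewrite (_ : (fun n => _) = (fun n => chi1 a%:Z / a%:R *
      (P n / \sum_(i < a) e2pi (q2%:R * zeta n) ^+ i))) //.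
  apply/funext => n.
  rewrite /lambert_term /lambert_kernel -/(P n) den.
  have -> : e2pi ((a * h)%N%:R / m%:R) = 1 :> R[i].
    by rewrite -{1}(divnK ma) mulnAC natrM mulfK // e2pi_nat.
  have -> : e2pi ((q2 * a)%N%:R * zeta n) = e2pi (q2%:R * zeta n) ^+ a.
    by rewrite mulnC natrM -mulrA e2piMn.
  rewrite mul1r.
  have E := subrX1 (e2pi (q2%:R * zeta n)) a.
  have hne : 1 - e2pi (q2%:R * zeta n) != 0.
    by rewrite one_sub_e2pi_neq0 // complex_ImMn mulr_gt0.
  have -> : 1 - e2pi (q2%:R * zeta n) ^+ a =
     (1 - e2pi (q2%:R * zeta n)) * \sum_(i < a) e2pi (q2%:R * zeta n) ^+ i.
    by rewrite -opprB E -mulNr opprB.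
  rewrite invfM; set S := (\sum_(i < a) _)^-1; field.
  by rewrite hne pnatr_eq0 -lt0n a0.
rewrite /term_limit (negPf nma).
have m1 : (1 < m)%N by rewrite ltn_neqAle m_gt0 andbT; apply: contraNneq nma => <-; exact: dvd1n.
(* The limit 0 is written as 0 times the finite limit of the term itself. *)
rewrite -(mul0r (chi1 a%:Z / a%:R *
   ((\sum_(b < q2) conj_character chi2 b%:Z * e2pi ((b * a)%N%:R * x)) /
    (1 - e2pi ((a * h)%N%:R / m%:R))))).
apply: ctendsM.
  by rewrite -(subrr 1); apply: ctendsB; [exact: ctends_cst|exact: he].
apply: ctendsM; first exact: ctends_cst.
apply: ctendsM; first exact: hP.
apply: ctendsV.
  rewrite subr_eq0 eq_sym (e2pi_div_exp R m).
  apply: contraNneq nma => /(e2pi_root_eq1 m1).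
  by rewrite Gauss_dvdl // coprime_sym.
under eq_fun do rewrite den.
apply: ctendsB; first exact: ctends_cst.
exact: ctends_mull1.
Qed.

End CuspAsymptotics.

(** * Distance to the integers, and a count of near-integral multiples *)

Section DistanceToIntegers.
Variable R : realType.

Lemma cabs_sub_e2pi_ge_dist (w : R[i]) (eta : R) :
  (forall j : int, eta <= `|complex.Re w - j%:~R|) -> eta <= cabs (1 - e2pi w).
Proof.
move=> hj; pose j := Num.floor (complex.Re w + 2^-1).
apply: (le_trans (hj j)); apply: cabs_sub_e2pi_ge.
have := floor_le_tmp (complex.Re w + 2^-1); have := floorD1_gt (complex.Re w + 2^-1).
rewrite -/j intrD ler_norml => h1 h2; apply/andP; split; lra.
Qed.

(** Such an [a] lies within [T] of [p / alpha], with [p <= P] because [p < (A + T) alpha]. Each [p]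
    accounts for at most [2 T + 2] values, listed from [c p - T] upwards, [c p] being the integer
    part of [p / alpha]. *)
Lemma count_near_multiples (M A T P : nat) (alpha : R) : 0 < alpha ->
  (A + T)%:R * alpha <= P%:R ->
  (count (fun a : nat => `[< exists p : nat, (`|a%:R * alpha - p%:R| < T%:R * alpha)%R >])
     (index_iota M A) <= P.+1 * (T + T).+2)%N.
Proof.
move=> al0 hP.
pose c p := Num.truncn (p%:R / alpha).
pose S := [seq (c p + i - T)%N | p <- iota 0 P.+1, i <- iota 0 (T + T).+2].
rewrite -size_filter.
have -> : (P.+1 * (T + T).+2 = size S)%N by rewrite size_allpairs !size_iota.
apply: uniq_leq_size; first by rewrite filter_uniq // iota_uniq.
move=> a; rewrite mem_filter mem_index_iota => /andP[/asboolP[p hp] /andP[Ma aA]].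
have [lo hi] : p%:R / alpha - T%:R < a%:R /\ a%:R < p%:R / alpha + T%:R.
  move: hp; rewrite ltr_norml => /andP[h1 h2]; split.
    by rewrite ltrBlDr ltr_pdivrMr // mulrDl; lra.
  by rewrite -ltrBlDr ltr_pdivlMr // mulrBl; lra.
have pa0 : 0 <= p%:R / alpha by rewrite divr_ge0 // ltW.
have c1 : (c p)%:R <= p%:R / alpha by rewrite truncn_le.
have c2 : p%:R / alpha < (c p).+1%:R by exact: truncnS_gt.
have n1 : (c p <= a + T)%N by rewrite -(ler_nat R) natrD; lra.
have n2 : (a < c p + T + 1)%N by rewrite -(ltr_nat R) !natrD; rewrite -natr1 in c2; lra.
have pP : (p <= P)%N.
  rewrite -(ler_nat R) (le_trans _ hP) //.
  have : a%:R <= A%:R :> R by rewrite ler_nat ltnW.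
  move/(ler_wpM2r (ltW al0)); rewrite natrD mulrDl.
  by move: hp; rewrite ltr_norml => /andP[h1 h2]; lra.
apply/allpairsP; exists (p, a + T - c p)%N; split; rewrite ?mem_iota /=.
- by [].
- by lia.
- by lia.
Qed.

Lemma sum_indicator (b : pred nat) (c : R) (r : seq nat) :
  \sum_(a <- r) (if b a then c else 0) = (count b r)%:R * c.
Proof.
by rewrite -big_mkcond big_const_seq iter_addr_0 mulr_natl.
Qed.

End DistanceToIntegers.

(** * Bounds for the terms of small and intermediate index *)

Section MiddleRange.
Variables (R : realType) (q1 q2 : nat) (chi1 chi2 : int -> R[i]) (m h : nat).
Hypotheses (q1_gt1 : (1 < q1)%N) (q2_gt1 : (1 < q2)%N).
Hypotheses (chi1_dirichlet : dirichlet_character q1 chi1)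
  (chi2_dirichlet : dirichlet_character q2 chi2) (m_gt0 : (0 < m)%N).

Let x : R[i] := h%:R / (q2 * m)%N%:R.
Let chi2c_dirichlet : dirichlet_character q2 (conj_character chi2).
Proof. exact: conj_dirichlet. Qed.
Let q2_gt0 : (0 < q2)%N. Proof. exact: ltnW. Qed.
Let q2R : 0 < q2%:R :> R. Proof. by rewrite ltr0n. Qed.
Let mR : 0 < m%:R :> R. Proof. by rewrite ltr0n. Qed.

Local Notation term := (lambert_term q2 chi1 chi2).
Local Notation kernel := (lambert_kernel q2 (conj_character chi2)).

Variables (v : R) (zeta : R[i]).
Let d : R := `|complex.Re zeta|.
Let y : R := complex.Im zeta.
Hypotheses (v_gt0 : 0 < v) (d_gt0 : 0 < d) (y_ge : v * d ^+ 2 <= y).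

Let y_gt0 : 0 < y.
Proof. by rewrite (lt_le_trans _ y_ge) // mulr_gt0 // exprn_gt0. Qed.

Let Im_z : complex.Im (x + zeta) = y.
Proof.
rewrite raddfD /= (_ : complex.Im x = 0) ?add0r //.
rewrite (_ : x = (h%:R / (q2 * m)%N%:R)%:C) //.
by rewrite fmorph_div !rmorph_nat.
Qed.

Let Im_az a : complex.Im (a%:R * (x + zeta)) = a%:R * y.
Proof. by rewrite complex_ImMn Im_z. Qed.

Let Re_qaz a : complex.Re (q2%:R * (a%:R * (x + zeta))) =
  (a * h)%N%:R / m%:R + q2%:R * a%:R * complex.Re zeta.
Proof.
rewrite !complex_ReMn raddfD /= (_ : x = (h%:R / (q2 * m)%N%:R)%:C) /=; last first.
  by rewrite fmorph_div !rmorph_nat.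
by rewrite !natrM; field; rewrite !gt_eqF.
Qed.

(** The displacement of [q2 a z] from the fraction [a h / m] is at most half the spacing [1 / m], so
    its distance to the integers is at least [q2 a d]. *)
Let kernel_small a : (0 < a)%N -> q2%:R * a%:R * d * (2 * m%:R) <= 1 ->
  cabs (kernel (a%:R * (x + zeta))) <= (a%:R * d)^-1.
Proof.
move=> a0 small; have aR : 0 < a%:R :> R by rewrite ltr0n.
have ad : 0 < a%:R * d by rewrite mulr_gt0.
have w0 : 0 < complex.Im (a%:R * (x + zeta)) by rewrite Im_az mulr_gt0.
have ge : q2%:R * a%:R * d <= cabs (1 - e2pi (q2%:R * (a%:R * (x + zeta)))).
  apply: cabs_sub_e2pi_ge_dist => j; rewrite Re_qaz.
  set th := q2%:R * a%:R * complex.Re zeta.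
  have th_d : `|th| = q2%:R * a%:R * d.
    by rewrite /th normrM ger0_norm // mulr_ge0 // ltW.
  rewrite -th_d; rewrite -th_d in small.
  have -> : (a * h)%N%:R / m%:R + th - j%:~R =
     ((a * h)%N%:Z - j * m%:Z)%:~R / m%:R + th :> R.
    by rewrite intrB intrM -!pmulrn; field; rewrite gt_eqF.
  set P := (_ - _ : int).
  have [->|P0] := eqVneq P 0; first by rewrite mul0r add0r.
  have P1 : 1 <= `|P%:~R : R| by rewrite -intr_norm -[1]/(1%:~R) ler_int -gtz0_ge1 normr_gt0.
  have P2 : 2 * `|th| <= `|P%:~R / m%:R : R|.
    rewrite [leRHS]normrM normfV (ger0_norm (ltW mR)) ler_pdivlMr //.
    by apply: le_trans P1; lra.
  have := ler_normB (P%:~R / m%:R + th) th; rewrite addrK; lra.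
rewrite (le_trans (cabs_kernel_le_den q2_gt1 chi2c_dirichlet w0)) //.
rewrite ler_pdivrMr; last by rewrite (lt_le_trans _ ge) // !mulr_gt0.
by rewrite ler_pdivlMl //; apply: le_trans ge; rewrite mulrC mulrA.
Qed.

(** Indices for which [a z] may come near a pole. All natural numbers [p] are allowed, whatever
    their residue modulo [m], to match [count_near_multiples] with [alpha = q2 m d]. *)
Let bad (T a : nat) : bool :=
  `[< exists p : nat, `|a%:R * (q2%:R * m%:R * d) - p%:R| < T%:R * (q2%:R * m%:R * d) >].

(** If the real part of [q2 a z] were within [q2 T d] of an integer [j], multiplying by [m] and
    taking absolute values would make [|a h - j m|] a witness of [bad]. *)
Let kernel_good T a : (0 < T)%N -> (0 < a)%N -> ~~ bad T a ->
  cabs (kernel (a%:R * (x + zeta))) <= (T%:R * d)^-1.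
Proof.
move=> T0 a0 /asboolPn nbad; have aR : 0 < a%:R :> R by rewrite ltr0n.
have TR : 0 < T%:R :> R by rewrite ltr0n.
have w0 : 0 < complex.Im (a%:R * (x + zeta)) by rewrite Im_az mulr_gt0.
have ge : q2%:R * (T%:R * d) <= cabs (1 - e2pi (q2%:R * (a%:R * (x + zeta)))).
  apply: cabs_sub_e2pi_ge_dist => j; rewrite Re_qaz leNgt; apply/negP => hlt.
  apply: nbad; pose P := ((a * h)%N%:Z - j * m%:Z : int).
  exists `|P|%N.
  have -> : `|P|%N%:R = `|- (P%:~R : R)| by rewrite normrN -intr_norm -abszE pmulrn.
  have -> : a%:R * (q2%:R * m%:R * d) = `|q2%:R * a%:R * m%:R * complex.Re zeta|.
    rewrite normrM ger0_norm /d; last by rewrite !mulr_ge0 // ltW.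
    by ring.
  apply: (le_lt_trans (ler_dist_dist _ _)).
  have -> : q2%:R * a%:R * m%:R * complex.Re zeta - - P%:~R =
     m%:R * ((a * h)%N%:R / m%:R + q2%:R * a%:R * complex.Re zeta - j%:~R) :> R.
    by rewrite /P intrB intrM -!pmulrn; field; rewrite gt_eqF.
  rewrite normrM (ger0_norm (ltW mR)).
  by rewrite (_ : T%:R * _ = m%:R * (q2%:R * (T%:R * d))) ?ltr_pM2l //; ring.
rewrite (le_trans (cabs_kernel_le_den q2_gt1 chi2c_dirichlet w0)) //.
rewrite ler_pdivrMr; last by rewrite (lt_le_trans _ ge) // !mulr_gt0.
by rewrite ler_pdivlMl ?mulr_gt0 // mulrC.
Qed.

(** The three summands majorize three regimes: small [a], larger [a] away from the poles, and larger
    [a] near a pole. Outside the first regime [1 / a < 2 m q2 d]. *)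
Lemma term_pointwise T a : (0 < T)%N -> (0 < a)%N ->
  cabs (term (x + zeta) a) <= d^-1 * (a%:R ^+ 2)^-1 + 2 * m%:R * q2%:R / T%:R
    + (if bad T a then 4 * m%:R ^+ 2 * q2%:R ^+ 3 / v else 0).
Proof.
move=> T0 a0; have aR : 0 < a%:R :> R by rewrite ltr0n.
have TR : 0 < T%:R :> R by rewrite ltr0n.
apply: le_trans; first exact: (cabs_lambert_term _ _ q1_gt1 chi1_dirichlet _ a0).
set K := cabs _.
have b1 : 0 <= d^-1 * (a%:R ^+ 2)^-1.
  by rewrite mulr_ge0 ?invr_ge0 ?sqr_ge0 // ltW.
have b2 : 0 <= 2 * m%:R * q2%:R / T%:R :> R by rewrite divr_ge0.
have b3 : 0 <= 4 * m%:R ^+ 2 * q2%:R ^+ 3 / v by rewrite divr_ge0 // ltW.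
have ai0 : 0 <= a%:R^-1 :> R by rewrite invr_ge0 ltW.
have [small|large] := lerP (q2%:R * a%:R * d * (2 * m%:R)) 1.
  apply: (@le_trans _ _ (d^-1 * (a%:R ^+ 2)^-1)); last by case: ifP => _; lra.
  have := ler_wpM2l ai0 (kernel_small a0 small).
  suff -> : a%:R^-1 * (a%:R * d)^-1 = d^-1 * (a%:R ^+ 2)^-1 by [].
  by field; rewrite !gt_eqF.
have ail : a%:R^-1 <= q2%:R * d * (2 * m%:R).
  by rewrite -div1r ler_pdivrMr // ltW // (lt_le_trans large) //; lra.
have [isbad|/(kernel_good T0 a0) good] := ifPn.
  apply: (@le_trans _ _ (4 * m%:R ^+ 2 * q2%:R ^+ 3 / v)); last lra.
  have w0 : 0 < complex.Im (a%:R * (x + zeta)) by rewrite Im_az mulr_gt0.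
  have := cabs_kernel_le q2_gt1 chi2c_dirichlet w0.
  rewrite Im_az -/K => hK; apply: (le_trans (ler_wpM2l ai0 hK)).
  have -> : a%:R^-1 * (q2%:R / (a%:R * y)) = a%:R^-1 ^+ 2 * (q2%:R / y).
    by field; rewrite !gt_eqF.
  (* The [d ^ 2] gained from [1 / a ^ 2] cancels the one in [y >= v d ^ 2], so a bad term is bounded
     independently of [d]. *)
  have -> : 4 * m%:R ^+ 2 * q2%:R ^+ 3 / v =
      (q2%:R * d * (2 * m%:R)) ^+ 2 * (q2%:R / (v * d ^+ 2)).
    by field; rewrite !gt_eqF.
  rewrite ler_pM ?sqr_ge0 ?divr_ge0 ?(ltW y_gt0) ?(ltW q2R) //.
    by rewrite ler_pXn2r // nnegrE !mulr_ge0 // ltW.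
  by rewrite ler_wpM2l ?(ltW q2R) // lef_pV2 ?posrE // mulr_gt0 // exprn_gt0.
apply: (@le_trans _ _ (2 * m%:R * q2%:R / T%:R)); last by rewrite addr0; lra.
apply: (le_trans (ler_pM ai0 (cabs_ge0 _) ail good)).
suff -> : q2%:R * d * (2 * m%:R) * (T%:R * d)^-1 = 2 * m%:R * q2%:R / T%:R by [].
by field; rewrite !gt_eqF.
Qed.

Lemma term_middle (M A T P : nat) : (0 < M)%N -> (0 < T)%N ->
  (A + T)%:R * (q2%:R * m%:R * d) <= P%:R ->
  \sum_(M <= a < A) cabs (term (x + zeta) a) <=
    d^-1 * (2 / M%:R) + A%:R * (2 * m%:R * q2%:R / T%:R)
    + (P.+1 * (T + T).+2)%N%:R * (4 * m%:R ^+ 2 * q2%:R ^+ 3 / v).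
Proof.
move=> M0 T0 hP.
have b2 : 0 <= 2 * m%:R * q2%:R / T%:R :> R by rewrite divr_ge0.
have b3 : 0 <= 4 * m%:R ^+ 2 * q2%:R ^+ 3 / v by rewrite divr_ge0 // ltW.
apply: (@le_trans _ _ (\sum_(M <= a < A) (d^-1 * (a%:R ^+ 2)^-1 + 2 * m%:R * q2%:R / T%:R
    + (if bad T a then 4 * m%:R ^+ 2 * q2%:R ^+ 3 / v else 0)))).
  by apply: ler_sum_nat => a /andP[Ma _]; apply: term_pointwise => //; exact: leq_trans Ma.
rewrite !big_split /= sum_indicator; apply: lerD; first apply: lerD.
- by rewrite -mulr_sumr ler_wpM2l ?invr_ge0 ?(ltW d_gt0) // sum_inv_sqr.
- by rewrite sumr_const_nat -[leLHS]mulr_natl ler_wpM2r // ler_nat leq_subr.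
- rewrite ler_wpM2r // ler_nat; apply: count_near_multiples => //.
  by rewrite !mulr_gt0.
Qed.

End MiddleRange.

(** * Exchange of limit and sum along the horocycle *)

Section CuspLimit.
Variables (R : realType) (q1 q2 : nat) (chi1 chi2 : int -> R[i]) (m h : nat).
Hypotheses (q1_gt1 : (1 < q1)%N) (q2_gt1 : (1 < q2)%N).
Hypotheses (chi1_dirichlet : dirichlet_character q1 chi1)
  (chi2_primitive : primitive_character q2 chi2).
Hypotheses (m_gt0 : (0 < m)%N) (hm_coprime : coprime h m).

Let x : R[i] := h%:R / (q2 * m)%N%:R.
Let chi2_dirichlet : dirichlet_character q2 chi2. Proof. by case: chi2_primitive. Qed.
Let q2_gt0 : (0 < q2)%N. Proof. exact: ltnW. Qed.
Let q2R : 0 < q2%:R :> R. Proof. by rewrite ltr0n. Qed.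
Let mR : 0 < m%:R :> R. Proof. by rewrite ltr0n. Qed.

Local Notation term := (lambert_term q2 chi1 chi2).
Let tau := gauss_sum q2 (conj_character chi2).

(** [L] is the value at 2 of the Dirichlet series of [chi1 chi2]; its first term, equal to 1,
    dominates all the others together. *)
Lemma dirichlet_series2 : exists2 L : R[i], L != 0 &
  forall M, (0 < M)%N ->
    cabs (L - \sum_(1 <= a < M) chi1 a%:Z * chi2 a%:Z / a%:R ^+ 2) <= 2 / M%:R.
Proof.
pose g (a : nat) : R[i] := chi1 a%:Z * chi2 a%:Z / a%:R ^+ 2.
have g_le a : (0 < a)%N -> cabs (g a) <= 1 / a%:R ^+ 2.
  move=> a0; rewrite /g 2!cabsM cabsV cabsX cabs_nat ler_wpM2r ?invr_ge0 ?sqr_ge0 //.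
  by rewrite mulr_ile1 ?cabs_ge0 ?(dirichlet_le1 q1_gt1 _ chi1_dirichlet)
    ?(dirichlet_le1 q2_gt1 _ chi2_dirichlet).
have [L [_ hL]] := cvg_inv_sqr_series ler01 g_le.
exists L; last by move=> M /hL; rewrite mulr1.
apply/negP => /eqP L0.
(* The term at 2 is at most 1/4 and those from 3 on at most 2/3; cutting at 48 costs 1/24, and
   [1/4 + 2/3 + 1/24 < 1]. *)
have := hL 48%N isT; rewrite L0 sub0r cabsN mulr1.
rewrite big_ltn // big_ltn //.
have := sum_cabs_inv_sqr 48 (isT : (0 < 3)%N) ler01 g_le; rewrite mulr1.
set S := \sum_(3 <= a < 48) _ => hS hT.
have g1 : g 1%N = 1.
  have [c1 _ _ _] := chi1_dirichlet; have [c2 _ _ _] := chi2_dirichlet.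
  by rewrite /g c1 c2 mulr1 expr1n divr1.
have g2 := g_le 2%N isT.
have e1 : 1 = (g 1%N + (g 2%N + S)) - (g 2%N + S) by rewrite g1; ring.
have := congr1 (@cabs R) e1; rewrite cabs1 => e2.
have := cabsBD (g 1%N + (g 2%N + S)) (g 2%N + S); rewrite -e2.
have := cabsD (g 2%N) S; lra.
Qed.

(** Only the multiples [a = b m] contribute; the cut at [M m] makes [b] range exactly below [M]. *)
Lemma sum_term_limit M :
  \sum_(1 <= a < M * m) term_limit q2 chi1 chi2 m h a =
  chi1 m%:Z * chi2 h%:Z * tau / m%:R ^+ 2 *
    \sum_(1 <= a < M) chi1 a%:Z * chi2 a%:Z / a%:R ^+ 2.
Proof.
rewrite /term_limit -big_mkcond -[LHS]big_filter.
rewrite (perm_big [seq (b * m)%N | b <- index_iota 1 M]); last first.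
  apply: uniq_perm.
  - by rewrite filter_uniq // iota_uniq.
  - rewrite map_inj_uniq ?iota_uniq // => b c /eqP.
    by rewrite eqn_pmul2r // => /eqP.
  move=> n; rewrite mem_filter mem_index_iota; apply/idP/mapP.
    case/andP=> /dvdnP[b ->] /andP[n1 nm].
    exists b => //; rewrite mem_index_iota; move: n1 nm.
    by rewrite muln_gt0 ltn_pmul2r // => /andP[-> _] ->.
  case=> b; rewrite mem_index_iota => /andP[h1 h2] ->.
  by rewrite dvdn_mull // muln_gt0 h1 m_gt0 ltn_pmul2r.
rewrite big_map mulr_sumr; apply: eq_big_nat => b /andP[b1 _].
have [_ M1 _ _] := chi1_dirichlet; have [_ M2 _ _] := chi2_dirichlet.
rewrite mulnK // !PoszM M1 M2 natrM -/tau; field.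
by rewrite !pnatr_eq0 -!lt0n b1 m_gt0.
Qed.

(** The tail is cut at [A], of order [W / d]: [term_middle] handles [M <= a < A] and
    [eichler_series_lambert] the rest. The prefactor, of order [d], absorbs the growth [1 / d] of
    these bounds. *)
Lemma tail_bound (v : R) (zeta : R[i]) (M W T : nat) :
  let d := `|complex.Re zeta| in let y := complex.Im zeta in
  let c := (((2 * W + T) * (q2 * m)).+1 * (T + T).+2)%N%:R *
             (4 * m%:R ^+ 2 * q2%:R ^+ 3 / v) in
  0 < v -> 0 < d -> d <= 1 -> M%:R * d <= 1 -> v * d ^+ 2 <= y -> y <= d ->
  (0 < M)%N -> (0 < W)%N -> (0 < T)%N ->
  cabs ((1 - e2pi (q2%:R * zeta)) *
    (eichler_series chi1 chi2 (x + zeta) - \sum_(1 <= a < M) term (x + zeta) a)) <=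
  32 * q2%:R * (2 / M%:R + 2 * W%:R * (2 * m%:R * q2%:R / T%:R) + d * c
                + 2 * q2%:R / (v * W%:R)).
Proof.
move=> d y c v0 d0 d1 Md ydd yd M0 W0 T0.
have y0 : 0 < y by rewrite (lt_le_trans _ ydd) // mulr_gt0 // exprn_gt0.
have WR : 1 <= W%:R :> R by rewrite ler1n.
have WR0 : 0 < W%:R :> R by rewrite ltr0n.
have TR : 0 < T%:R :> R by rewrite ltr0n.
have MR : 0 < M%:R :> R by rewrite ltr0n.
have qm0 : 0 <= q2%:R * m%:R :> R by rewrite mulr_ge0 // ltW.
(* This choice gives [W <= A d <= 2 W], the upper bound using [d <= 1 <= W]. *)
pose A := (Num.truncn (W%:R / d)).+1.
have WA : W%:R <= A%:R * d by rewrite -ler_pdivrMr // ltW // truncnS_gt.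
have AW : A%:R * d <= 2 * W%:R.
  have : (Num.truncn (W%:R / d))%:R <= W%:R / d by rewrite truncn_le // divr_ge0 // ltW.
  by rewrite ler_pdivlMr // /A -natr1 mulrDl; lra.
have MA : (M <= A)%N.
  rewrite -(ler_nat R) -(ler_pM2r d0); lra.
have AR : 0 < A%:R :> R by rewrite ltr0n.
have Imz : complex.Im (x + zeta) = y.
  rewrite raddfD /= (_ : complex.Im x = 0) ?add0r //.
  rewrite (_ : x = (h%:R / (q2 * m)%N%:R)%:C) //.
  by rewrite fmorph_div !rmorph_nat.
have hA : cabs (eichler_series chi1 chi2 (x + zeta) - \sum_(1 <= a < A) term (x + zeta) a)
     <= 2 * (q2%:R / y) / A%:R.
  rewrite -Imz; apply: (eichler_series_lambert q1_gt1) => //.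
  by rewrite Imz.
have hmid : cabs (\sum_(M <= a < A) term (x + zeta) a) <= d^-1 * (2 / M%:R)
     + A%:R * (2 * m%:R * q2%:R / T%:R) + c.
  apply: (le_trans (cabs_sum _ _ _)).
  apply: (term_middle h q1_gt1 q2_gt1 chi1_dirichlet chi2_dirichlet m_gt0 v0 d0 ydd M0 T0).
  rewrite natrD !natrM [(2 * W + T)%:R]natrD natrM.
  have -> : (A%:R + T%:R) * (q2%:R * m%:R * d) =
            (A%:R * d + T%:R * d) * (q2%:R * m%:R) by ring.
  by rewrite ler_wpM2r // lerD // ler_piMr // ltW.
have split : eichler_series chi1 chi2 (x + zeta) - \sum_(1 <= a < M) term (x + zeta) a
   = (eichler_series chi1 chi2 (x + zeta) - \sum_(1 <= a < A) term (x + zeta) a)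
     + \sum_(M <= a < A) term (x + zeta) a.
  by rewrite [X in _ - X + _](@big_cat_nat _ _ _ M) //=; ring.
(* The constant is [16 * 2], from [4 pi <= 16] and [d + y <= 2 d]. *)
have he : cabs (1 - e2pi (q2%:R * zeta)) <= 32 * q2%:R * d.
  rewrite cabsB (le_trans (cabs_e2pi_sub1 _)) ?complex_ImMn ?mulr_ge0 // ?(ltW y0) //.
  rewrite complex_ReMn normrM ger0_norm // -mulrDr -/d -/y.
  have p4 : 4 * pi <= 16 :> R by have := pihalf_lt2 R; lra.
  have dy : q2%:R * (d + y) <= q2%:R * (d + d) by rewrite ler_wpM2l // lerD2l.
  have p0 : 0 <= 4 * pi :> R by rewrite mulr_ge0 // pi_ge0.
  have q0 : 0 <= q2%:R * (d + y) by rewrite mulr_ge0 // addr_ge0 // ltW.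
  by apply: (le_trans (ler_pM p0 q0 p4 dy)); lra.
rewrite cabsM split.
apply: (le_trans (ler_pM (cabs_ge0 _) (cabs_ge0 _) he
  (le_trans (cabsD _ _) (lerD hA hmid)))).
rewrite -[leLHS]mulrA ler_wpM2l ?mulr_ge0 // mulrDr addrC lerD //.
  rewrite !mulrDr lerD // lerD //; first by rewrite mulVKf // gt_eqF.
  have b2 : 0 <= 2 * m%:R * q2%:R / T%:R :> R by rewrite divr_ge0.
  by have := ler_wpM2r b2 AW; lra.
have -> : d * (2 * (q2%:R / y) / A%:R) = 2 * q2%:R * (d / (y * A%:R)).
  by field; rewrite !gt_eqF.
rewrite ler_wpM2l ?mulr_ge0 // ler_pdivrMr ?mulr_gt0 // ler_pdivlMl ?mulr_gt0 //.
have h1 := ler_wpM2r (ltW AR) ydd.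
apply: le_trans h1.
have := ler_wpM2l (ltW (mulr_gt0 v0 d0)) WA; lra.
Qed.

(** The parameters are chosen in the order [M], [W], then [T] depending on [W], and last the range
    of [n]. Six errors of size [e / 6] arise: four from [tail_bound], one from the finite part and
    one from the tail of [L]. *)
Lemma cusp_limit (L : R[i]) (v : R) (zeta : nat -> R[i]) :
  (forall M, (0 < M)%N ->
    cabs (L - \sum_(1 <= a < M) chi1 a%:Z * chi2 a%:Z / a%:R ^+ 2) <= 2 / M%:R) ->
  0 < v -> ctends zeta 0 ->
  (forall n, [/\ complex.Re (zeta n) != 0,
     v * complex.Re (zeta n) ^+ 2 <= complex.Im (zeta n)
     & complex.Im (zeta n) <= `|complex.Re (zeta n)|]) ->
  ctends (fun n => (1 - e2pi (q2%:R * zeta n)) * eichler_series chi1 chi2 (x + zeta n))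
    (chi1 m%:Z * chi2 h%:Z * tau / m%:R ^+ 2 * L).
Proof.
move=> hL v0 zeta0 hzeta.
have d0 n : 0 < `|complex.Re (zeta n)| by rewrite normr_gt0; case: (hzeta n).
have y0 n : 0 < complex.Im (zeta n).
  have [h1 h2 _] := hzeta n; apply: lt_le_trans h2.
  by rewrite mulr_gt0 // lt_def sqrf_eq0 h1 sqr_ge0.
set K := chi1 _ * _ * _ / _.
apply/ctendsP => e e0.
have e6 : 0 < e / 6 by rewrite divr_gt0.
have [M1 hM1] := near_inv_nat (32 * q2%:R * 2) e6.
have [M2 hM2] := near_inv_nat (cabs K * 2) e6.
pose M := maxn M1 M2.
have [M0 hM1'] := hM1 M (leq_maxl _ _).
have [_ hM2'] := hM2 M (leq_maxr _ _).
have [W hW] := near_inv_nat (32 * q2%:R * (2 * q2%:R / v)) e6.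
have {hW} [W0 hW] := hW W (leqnn _).
have [T hT] := near_inv_nat (32 * q2%:R * (2 * W%:R * (2 * m%:R * q2%:R))) e6.
have {hT} [T0 hT] := hT T (leqnn _).
pose c := (((2 * W + T) * (q2 * m)).+1 * (T + T).+2)%N%:R *
             (4 * m%:R ^+ 2 * q2%:R ^+ 3 / v).
have c0 : 0 <= c by rewrite mulr_ge0 // divr_ge0 // ltW.
have [j hj] := near_inv_nat (32 * q2%:R * c) e6.
have {hj} [j0 hj] := hj j (leqnn _).
(* With [d = |Re (zeta n)|], once [N d <= 1] both [M m d <= 1], as [tail_bound] asks, and
   [j d <= 1], which makes the contribution of [d c] small. *)
pose N := maxn (M * m) j.
have N0 : (0 < N)%N by rewrite leq_max j0 orbT.
have NR : 0 < N%:R :> R by rewrite ltr0n.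
have d_small : 0 < N%:R^-1 :> R by rewrite invr_gt0.
have [n1 hn1] := (ctendsP _ _).2 zeta0 _ d_small.
have fin : ctends (fun n => \sum_(1 <= a < M * m)
    (1 - e2pi (q2%:R * zeta n)) * term (x + zeta n) a)
    (\sum_(1 <= a < M * m) term_limit q2 chi1 chi2 m h a).
  rewrite big_seq; under eq_fun do rewrite big_seq.
  apply: ctends_sum => a; rewrite mem_index_iota => /andP[a0 _].
  exact: term_tends.
have [n2 hn2] := (ctendsP _ _).2 fin _ e6.
exists (maxn n1 n2) => n; rewrite geq_max => /andP[/hn1 {}hn1 /hn2 {}hn2].
have dN : N%:R * `|complex.Re (zeta n)| <= 1.
  rewrite subr0 in hn1; have := le_trans (Re_le_cabs _) hn1.
  by rewrite -[N%:R^-1]mul1r ler_pdivlMr // mulrC.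
have NM (k : nat) : (k <= N)%N -> k%:R * `|complex.Re (zeta n)| <= 1.
  by move=> kN; apply: le_trans dN; rewrite ler_wpM2r // ler_nat.
have [_ h2 h3] := hzeta n.
have h2' : v * `|complex.Re (zeta n)| ^+ 2 <= complex.Im (zeta n).
  by rewrite real_normK ?num_real.
have d1 : `|complex.Re (zeta n)| <= 1 by have := NM 1%N N0; rewrite mul1r.
have Mm0 : (0 < M * m)%N by rewrite muln_gt0 M0.
have tb := tail_bound v0 (d0 n) d1 (NM _ (leq_maxl _ _)) h2' h3 Mm0 W0 T0.
rewrite -/c in tb.
rewrite sum_term_limit -/K in hn2.
set S := \sum_(1 <= a < M) _ in hn2.
set E := 1 - e2pi _ in tb hn2 *.
set f := eichler_series _ _ _ in tb *.
rewrite -mulr_sumr in hn2; set G := \sum_(1 <= a < M * m) _ in tb hn2.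
have -> : E * f - K * L = E * (f - G) + (E * G - K * S) + K * (S - L) by ring.
have hKL : cabs (K * (S - L)) <= e / 6.
  rewrite cabsM cabsB; apply: le_trans hM2'.
  by rewrite -mulrA ler_wpM2l ?cabs_ge0 // hL.
have MR : 0 < M%:R :> R by rewrite ltr0n.
have WR : 0 < W%:R :> R by rewrite ltr0n.
have TR : 0 < T%:R :> R by rewrite ltr0n.
have jR : 0 < j%:R :> R by rewrite ltr0n.
have qq : 0 <= 32 * q2%:R :> R by rewrite mulr_ge0.
have t1 : 32 * q2%:R * (2 / (M * m)%N%:R) <= e / 6.
  apply: le_trans hM1'; rewrite -!mulrA !ler_wpM2l // lef_pV2 ?posrE ?ltr0n //.
  by rewrite ler_nat leq_pmulr.
have t2 : 32 * q2%:R * (2 * W%:R * (2 * m%:R * q2%:R / T%:R)) <= e / 6.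
  by apply: le_trans hT; rewrite !mulrA.
have t3 : 32 * q2%:R * (`|complex.Re (zeta n)| * c) <= e / 6.
  apply: le_trans hj; rewrite -[leRHS]mulrA ler_wpM2l // mulrC ler_wpM2l //.
  by rewrite -[j%:R^-1]mul1r ler_pdivlMr // mulrC NM // leq_maxr.
have t4 : 32 * q2%:R * (2 * q2%:R / (v * W%:R)) <= e / 6.
  by apply: le_trans hW; rewrite invfM !mulrA.
apply: (le_trans (cabsD _ _)).
have := cabsD (E * (f - G)) (E * G - K * S).
have tb' : cabs (E * (f - G)) <= 4 * (e / 6).
  by apply: (le_trans tb); rewrite !mulrDr; lra.
lra.
Qed.

End CuspLimit.

(** * Independence of multiplicative functions, and coprime representatives *)

Lemma characters_independent (K : idomainType) (T : Type) (op : T -> T -> T) (e : T)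
    (n : nat) (X : 'I_n -> T -> K) (c : 'I_n -> K) :
  (forall k, X k e = 1) -> (forall k x y, X k (op x y) = X k x * X k y) ->
  (forall i j, (forall x, X i x = X j x) -> i = j) ->
  (forall x, \sum_(k < n) c k * X k x = 0) -> forall k, c k = 0.
Proof.
elim: n X c => [|n IH] X c X1 XM Xinj H; first by case.
have c_lift i : c (lift ord0 i) = 0.
  have hy y j : c (lift ord0 j) * (X (lift ord0 j) y - X ord0 y) = 0.
    pose X' j := X (lift ord0 j).
    pose c' j := c (lift ord0 j) * (X' j y - X ord0 y).
    apply: (IH X' c') => [k|k u w|k l kl|x].
    - exact: X1.
    - exact: XM.
    - by apply: (@lift_inj _ ord0); apply: Xinj.
    (* Artin's elimination: the relation at [op y x] minus [X ord0 y] times the relation at [x] no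
       longer involves [X ord0]. *)
    have h1 := H (op y x); have h2 := H x.
    rewrite big_ord_recl in h1; rewrite big_ord_recl in h2.
    have -> : \sum_(k < n) c' k * X' k x =
        (c ord0 * X ord0 (op y x) + \sum_(k < n) c (lift ord0 k) * X (lift ord0 k) (op y x))
        - X ord0 y * (c ord0 * X ord0 x + \sum_(k < n) c (lift ord0 k) * X (lift ord0 k) x).
      rewrite mulrDr XM opprD addrACA [X in X + _](_ : _ = 0) ?add0r; last by ring.
      rewrite mulr_sumr -sumrB; apply: eq_bigr => k _.
      by rewrite XM /c' /X'; ring.
    by rewrite h1 h2 mulr0 subrr.
  have [y hy'] : exists y, X (lift ord0 i) y <> X ord0 y.
    apply/existsNP => heq; have /Xinj := heq => /eqP.
    by rewrite eq_sym (negPf (neq_lift _ _)).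
  by have /eqP := hy y i; rewrite mulf_eq0 subr_eq0 => /orP[/eqP //|/eqP/hy'].
move=> k; have [j ->|->] := unliftP ord0 k; first exact: c_lift.
have := H e; rewrite big_ord_recl big1 => [|j _]; last by rewrite c_lift mul0r.
by rewrite addr0 X1 mulr1.
Qed.

(** Take for [t] the part of [m] prime to [a]. A prime factor of [m] dividing [a] divides neither
    [b] nor [t]; one not dividing [a] divides [t]. In both cases it does not divide [a + b t]. *)
Lemma coprime_shift (a b m : nat) : (0 < a)%N -> (0 < m)%N -> coprime a b ->
  exists t, coprime (a + b * t) m.
Proof.
move=> a0 m0 co; exists (m`_(\pi(a)^'))%N.
set t := (m`__)%N; set g := gcdn (a + b * t) m.
have g0 : (0 < g)%N by rewrite gcdn_gt0 m0 orbT.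
rewrite /coprime -/g eqn_leq g0 andbT leqNgt; apply/negP => g1.
pose p := pdiv g; have pp : prime p by exact: pdiv_prime.
have pg : (p %| g)%N by exact: pdiv_dvd.
have pa : (p %| a + b * t)%N := dvdn_trans pg (dvdn_gcdl _ _).
have pm : (p %| m)%N := dvdn_trans pg (dvdn_gcdr _ _).
have pt : (p %| t)%N = (p \notin \pi(a)).
  have := primes_part (\pi(a)^')%N m => /(congr1 (fun s => p \in s)).
  by rewrite mem_filter !mem_primes pp pm m0 /= part_gt0 /= ?andbT -/t => ->; rewrite inE /= mem_primes pp.
have [pia|npia] := boolP (p \in \pi(a)).
  have pda : (p %| a)%N by move: pia; rewrite mem_primes => /and3P[].
  move: pa; rewrite dvdn_addr // Euclid_dvdM // pt pia orbF => pb.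
  have : (p %| gcdn a b)%N by rewrite dvdn_gcd pda.
  by rewrite (eqP co) dvdn1 => /eqP p1; rewrite p1 in pp.
move: pa; rewrite dvdn_addl; last by rewrite dvdn_mull // pt.
by move=> pda; case/negP: npia; rewrite mem_primes pp pda a0.
Qed.

(** * Parabolic orbits and horocycles *)

Section Orbit.
Variable R : realType.

(* In terms of u - i v = 1 / s, this is 1 / zeta = (u - B) - i v: as B grows, zeta runs
   to 0 along a horocycle. *)
Lemma horocycle (s : R[i]) : 0 < complex.Im s ->
  exists v (n0 : nat), 0 < v /\ forall B : nat,
    let zeta := s / (1 - (n0 + B)%N%:R * s) in
    [/\ complex.Re zeta != 0, v * complex.Re zeta ^+ 2 <= complex.Im zeta,
        complex.Im zeta <= `|complex.Re zeta| & cabs zeta <= B.+1%:R^-1].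
Proof.
move=> s0.
have sne : s != 0 by apply: contraTneq s0 => ->; rewrite ltxx.
pose a := complex.Re s; pose b := complex.Im s.
pose u0 := a / (a ^+ 2 + b ^+ 2); pose v := b / (a ^+ 2 + b ^+ 2).
have n2 : 0 < a ^+ 2 + b ^+ 2 by rewrite ltr_wpDl ?sqr_ge0 // exprn_gt0.
have v0 : 0 < v by rewrite divr_gt0.
have es : s^-1 = u0 -i* v.
  by rewrite /u0 /v /a /b; case: (s) => x y.
(* This offset gives [u0 + v + 1 < n0], so that [- u > v + B + 1] for every [B]; the last two bounds
   rely on it. *)
pose n0 := (Num.truncn `|u0 + v|).+2.
have hn0 : u0 + v + 1 < n0%:R.
  by rewrite -natr1 ltrD2r (le_lt_trans (ler_norm _)) // truncnS_gt.
exists v, n0; split=> // B; set zeta := s / _.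
pose u := u0 - (n0 + B)%N%:R.
have hu : u < - v - B%:R - 1 by rewrite /u natrD; lra.
have B0 : 0 <= B%:R :> R by [].
have u2 : 0 < u ^+ 2 + v ^+ 2 by rewrite ltr_wpDl ?sqr_ge0 // exprn_gt0.
have ez : zeta = (u / (u ^+ 2 + v ^+ 2)) +i* (v / (u ^+ 2 + v ^+ 2)).
  have -> : zeta = (s^-1 - (n0 + B)%N%:R)^-1.
    rewrite /zeta -{1}[s]invrK -invfM; congr _^-1.
    by rewrite mulrBr mulr1 mulrCA mulVf // mulr1.
  rewrite es -(rmorph_nat (real_complex R)) /=.
  rewrite (_ : _ - _ = u -i* v); last by apply/eqP; rewrite eq_complex /= subr0 !eqxx.
  by apply/eqP; rewrite eq_complex /= !sqrrN mulNr opprK !eqxx.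
rewrite ez /=; split.
- by rewrite mulf_neq0 ?invr_eq0 ?(gt_eqF u2) // lt_eqF //; lra.
- rewrite exprMn exprVn; set D := u ^+ 2 + v ^+ 2 in u2 *.
  rewrite mulrA expr2 invfM mulrA ler_wpM2r ?invr_ge0 ?(ltW u2) //.
  by rewrite ler_pdivrMr // ler_wpM2l ?(ltW v0) // lerDl sqr_ge0.
- rewrite normrM [`|_^-1|]ger0_norm ?invr_ge0 ?(ltW u2) //.
  by rewrite ler_wpM2r ?invr_ge0 ?(ltW u2) // ltr0_norm; lra.
have : cabs zeta ^+ 2 = (u ^+ 2 + v ^+ 2)^-1.
  by rewrite cabs_sqr ez /=; field; rewrite gt_eqF.
rewrite -ez => hz.
have B1 : 0 < B.+1%:R :> R by rewrite ltr0n.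
rewrite -(@ler_pXn2r _ 2) ?nnegrE ?cabs_ge0 ?invr_ge0 ?(ltW B1) // hz exprVn.
rewrite lef_pV2 ?posrE ?exprn_gt0 //.
apply: (@le_trans _ _ (u ^+ 2)); last by rewrite lerDl sqr_ge0.
have hB : B.+1%:R <= - u by rewrite -natr1; lra.
have u1 : 0 <= - u by exact: le_trans (ltW B1) hB.
by rewrite -[u ^+ 2]sqrrN ler_pXn2r ?nnegrE ?(ltW B1).
Qed.

(** The matrix is a parabolic element fixing [h / K]; in the coordinate [1 / (z - h / K)] it acts as
    the translation by [- n N K ^ 2]. *)
Lemma parabolic_orbit (N h K n : nat) (z : R[i]) : (0 < K)%N -> 0 < complex.Im z ->
  exists2 g : 'M[int]_2, Gamma1 N g &
    let s := z - h%:R / K%:R in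
    mobius g z = h%:R / K%:R + s / (1 - (n * N * K ^ 2)%N%:R * s).
Proof.
move=> K0 z0.
pose A : int := 1 - (n * N * h * K)%N%:Z.
pose D : int := 1 + (n * N * h * K)%N%:Z.
pose B : int := (n * N * h ^ 2)%N%:Z.
pose C : int := - (n * N * K ^ 2)%N%:Z.
pose g : 'M[int]_2 := \matrix_(i, j)
  (if i == 0 then if j == 0 then A else B else if j == 0 then C else D).
exists g.
  split; first split.
  - rewrite (expand_det_row _ 0) !big_ord_recl big_ord0 /cofactor !det_mx11 !mxE /=.
    rewrite /bump /= /A /B /C /D !PoszM; ring.
  - by rewrite mxE /= /C dvdzE abszN /= -mulnA dvdn_mull // dvdn_mulr.
  - rewrite mxE /= /A; apply/eqP; rewrite eqz_mod_dvd addrAC subrr add0r dvdzE abszN /=.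
    by rewrite -!mulnA dvdn_mull // dvdn_mulr.
  - rewrite mxE /= /D; apply/eqP; rewrite eqz_mod_dvd addrAC subrr add0r dvdzE /=.
    by rewrite -!mulnA dvdn_mull // dvdn_mulr.
move=> s; rewrite /mobius !mxE /=.
have KC : K%:R != 0 :> R[i] by rewrite pnatr_eq0 -lt0n.
have e1 : A%:~R * z + B%:~R = h%:R / K%:R * (1 - (n * N * K ^ 2)%N%:R * s) + s :> R[i].
  rewrite /A /B /s intrB -!pmulrn !natrM; field.
  exact: KC.
have e2 : C%:~R * z + D%:~R = 1 - (n * N * K ^ 2)%N%:R * s :> R[i].
  rewrite /C /D /s mulrNz intrD -!pmulrn !natrM; field.
  exact: KC.
rewrite e1 e2 mulrDl mulfK //.
(* If the denominator were 0, its imaginary part would force [n N K ^ 2 = 0], and the denominator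
   would be 1. *)
apply/negP => /eqP den0; have := congr1 (@complex.Im R) den0.
rewrite raddfB /= complex_ImMn sub0r raddfB /=.
have -> : complex.Im (h%:R / K%:R : R[i]) = 0.
  by rewrite -(rmorph_nat (real_complex R) h) -(rmorph_nat (real_complex R) K) -fmorph_div.
rewrite subr0 => /eqP; rewrite oppr_eq0 mulf_eq0 (gt_eqF z0) orbF pnatr_eq0 => /eqP W0.
by move/eqP: den0; rewrite W0 mul0r subr0 oner_eq0.
Qed.

End Orbit.

(** * From invariance under [Gamma1] to relations between characters *)

Lemma psi_Gamma1 (R : realType) (q1 q2 : nat) (chi1 chi2 : int -> R[i]) (g : 'M[int]_2) :
  (1 < q1)%N -> (1 < q2)%N ->
  dirichlet_character q1 chi1 -> dirichlet_character q2 chi2 ->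
  Gamma1 (q1 * q2) g -> psi_character chi1 chi2 g = 1.
Proof.
move=> h1 h2 c1 c2 [_ _ /eqP]; rewrite eqz_mod_dvd PoszM => hd.
rewrite /psi_character (dirichlet_congr (n := 1) c1); last first.
  by apply/eqP; rewrite eqz_mod_dvd (dvdz_trans _ hd) // dvdz_mulr.
rewrite (dirichlet_congr (n := 1) (conj_dirichlet c2)); last first.
  by apply/eqP; rewrite eqz_mod_dvd (dvdz_trans _ hd) // dvdz_mull.
have [-> _ _ _] := c1; have [-> _ _ _] := conj_dirichlet c2.
by rewrite mulr1.
Qed.

Section Relations.
Variables (R : realType) (q1 q2 : nat).
Hypotheses (q1_gt1 : (1 < q1)%N) (q2_gt1 : (1 < q2)%N).

(* The series is constant along an orbit, while along a horocyclic part of that orbit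
   the terms of the left-hand side are the leading coefficients of its growth. *)
Lemma cusp_relation (z : R[i]) (n : nat) (chi1 chi2 : 'I_n -> int -> R[i])
    (L c : 'I_n -> R[i]) (m h : nat) : 0 < complex.Im z ->
  (forall k, dirichlet_character q1 (chi1 k)) ->
  (forall k, primitive_character q2 (chi2 k)) ->
  (forall k M, (0 < M)%N ->
    cabs (L k - \sum_(1 <= a < M) chi1 k a%:Z * chi2 k a%:Z / a%:R ^+ 2) <= 2 / M%:R) ->
  (forall g, Gamma1 (q1 * q2) g ->
    \sum_(k < n) c k * eichler_series (chi1 k) (chi2 k) (mobius g z) =
    \sum_(k < n) c k * eichler_series (chi1 k) (chi2 k) z) ->
  (0 < m)%N -> coprime h m ->
  \sum_(k < n) c k * gauss_sum q2 (conj_character (chi2 k)) * L k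
    * (chi1 k m%:Z * chi2 k h%:Z) = 0.
Proof.
move=> z0 hc1 hc2 hL inv m0 co.
have q2_0 : (0 < q2)%N by exact: ltnW.
pose K := (q2 * m)%N.
have K0 : (0 < K)%N by rewrite muln_gt0 q2_0.
pose N := (q1 * q2)%N.
have N0 : (0 < N)%N by rewrite muln_gt0 q2_0 (ltnW q1_gt1).
pose x : R[i] := h%:R / K%:R.
pose s := z - x.
have s0 : 0 < complex.Im s.
  rewrite raddfB /= (_ : complex.Im x = 0) ?subr0 //.
  by rewrite /x -(rmorph_nat (real_complex R) h) -(rmorph_nat (real_complex R) K) -fmorph_div.
have [v [n0 [v0 hv]]] := horocycle s0.
pose zeta (j : nat) : R[i] := s / (1 - ((n0 + j) * N * K ^ 2)%N%:R * s).
(* As [N K ^ 2 >= 1], the translation length [(n0 + j) N K ^ 2] has the form [n0 + B] with [B >= j],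
   so the estimates of [horocycle] apply. *)
have hz j : exists2 B, (j <= B)%N & zeta j = s / (1 - (n0 + B)%N%:R * s).
  have NK : (0 < N * K ^ 2)%N by rewrite muln_gt0 N0 expn_gt0 K0.
  exists ((n0 + j) * N * K ^ 2 - n0)%N; first by nia.
  by rewrite /zeta subnKC //; nia.
have zeta0 : ctends zeta 0.
  apply/ctendsP => e e0; have [M hM] := near_inv_nat 1 e0.
  exists M => j Mj; have [B jB ->] := hz j; have [_ _ _ hb] := hv B.
  rewrite subr0; apply: (le_trans hb).
  have [_] := hM B.+1 (leq_trans Mj (leqW jB)); rewrite mul1r; exact.
have hzeta j : [/\ complex.Re (zeta j) != 0,
    v * complex.Re (zeta j) ^+ 2 <= complex.Im (zeta j)
    & complex.Im (zeta j) <= `|complex.Re (zeta j)|].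
  by have [B _ ->] := hz j; have [? ? ? _] := hv B.
pose E j := 1 - e2pi (q2%:R * zeta j).
pose F0 := \sum_(k < n) c k * eichler_series (chi1 k) (chi2 k) z.
pose Lam k := chi1 k m%:Z * chi2 k h%:Z * gauss_sum q2 (conj_character (chi2 k))
              / m%:R ^+ 2 * L k.
have lim1 : ctends (fun j => \sum_(k < n) c k *
    (E j * eichler_series (chi1 k) (chi2 k) (x + zeta j))) (\sum_(k < n) c k * Lam k).
  apply: ctends_sum => k _; apply: ctendsM; first exact: ctends_cst.
  exact: (cusp_limit q1_gt1 q2_gt1 (hc1 k) (hc2 k) m0 co (hL k) v0 zeta0 hzeta).
have Im0 j : 0 <= complex.Im (zeta j).
  have [h1 h2 _] := hzeta j; apply: le_trans h2.
  by rewrite mulr_ge0 ?sqr_ge0 // ltW.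
(* By invariance the same sequence is [E j] times a constant, hence tends to 0. *)
have lim2 : ctends (fun j => E j * F0) ((1 - 1) * F0).
  apply: ctendsM; last exact: ctends_cst.
  by apply: ctendsB; [exact: ctends_cst | exact: e2pi_tends].
have eqs : (fun j => \sum_(k < n) c k *
    (E j * eichler_series (chi1 k) (chi2 k) (x + zeta j))) = (fun j => E j * F0).
  apply/funext => j.
  have [g hg /= eg] := parabolic_orbit N h (n0 + j) K0 z0.
  rewrite /F0 -(inv g hg) eg -/x -/s -/(zeta j) mulr_sumr.
  by apply: eq_bigr => k _; ring.
rewrite eqs in lim1; have := ctends_unique lim1 lim2.
rewrite subrr mul0r => sum0.
have mC : m%:R ^+ 2 != 0 :> R[i] by rewrite expf_neq0 // pnatr_eq0 -lt0n.
transitivity (m%:R ^+ 2 * \sum_(k < n) c k * Lam k); last by rewrite sum0 mulr0.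
rewrite mulr_sumr; apply: eq_bigr => k _.
by rewrite /Lam; field; rewrite pnatr_eq0 -lt0n.
Qed.

(** Both sides depend only on residues. If [h] is prime to [q2], adding a multiple of [q2] makes it
    prime to [m]; otherwise every [chi2 k h] is 0. *)
Lemma relation_all_residues (n : nat) (chi1 chi2 : 'I_n -> int -> R[i])
    (d : 'I_n -> R[i]) :
  (forall k, dirichlet_character q1 (chi1 k)) ->
  (forall k, dirichlet_character q2 (chi2 k)) ->
  (forall m h : nat, (0 < m)%N -> coprime h m ->
    \sum_(k < n) d k * (chi1 k m%:Z * chi2 k h%:Z) = 0) ->
  forall m h : int, \sum_(k < n) d k * (chi1 k m * chi2 k h) = 0.
Proof.
move=> hc1 hc2 rel m h.
have [m' m0 hm] := dirichlet_repr q1_gt1 m.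
have [h' h0 hh] := dirichlet_repr q2_gt1 h.
have [co|nco] := boolP (coprime h' q2).
  have [t ct] := coprime_shift h0 m0 co.
  rewrite -[RHS](rel _ _ m0 ct); apply: eq_bigr => k _; congr (_ * (_ * _)).
    by apply: (dirichlet_congr (hc1 k)).
  apply: (dirichlet_congr (hc2 k)); rewrite -hh PoszD PoszM.
  by rewrite [(q2%:Z * _)%R]mulrC addrC modzMDl.
apply: big1 => k _; rewrite -(dirichlet_congr (hc2 k) hh).
have [_ _ _ hu] := hc2 k.
have -> : chi2 k h'%:Z = 0 by apply/eqP; rewrite -[_ == _]negbK hu coprimezE.
by rewrite !mulr0.
Qed.

End Relations.

Theorem proposition1p8 (R : realType) (q1 q2 : nat) (hq1 : (1 < q1)%N) (hq2 : (1 < q2)%N)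
    (z : R[i]) (hz : 0 < complex.Im z) :
  linearly_independent_on
    (@admissible_pair R q1 q2)
    (Gamma1 (q1 * q2))
    (fun p g => newform_dedekind_sum q1 p.1 p.2 z g).
Proof.
move=> n s s_inj hs c rel.
have p1 k : primitive_character q1 (s k).1 by have [] := hs k.
have p2 k : primitive_character q2 (s k).2 by have [] := hs k.
have d1 k : dirichlet_character q1 (s k).1 by have [] := p1 k.
have d2 k : dirichlet_character q2 (s k).2 by have [] := p2 k.
have /choice[L hL] k : exists L : R[i], L != 0 /\ forall M, (0 < M)%N ->
    cabs (L - \sum_(1 <= a < M) (s k).1 a%:Z * (s k).2 a%:Z / a%:R ^+ 2) <= 2 / M%:R.
  by have [L L0 hL] := dirichlet_series2 hq1 hq2 (d1 k) (p2 k); exists L.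
have L0 k : L k != 0 by have [] := hL k.
have Lb k := (hL k).2.
pose w k : R[i] := gauss_sum q1 (conj_character (s k).1) / (pi%:C * 'i%C).
have w0 k : w k != 0.
  rewrite mulf_neq0 ?gauss_sum_neq0 // invr_neq0 // mulf_neq0 //.
    by rewrite eq_complex /= eqxx andbT gt_eqF // pi_gt0.
  by rewrite eq_complex /= oner_eq0 andbF.
pose c' k := c k * w k.
(* Since [psi] is 1 on this group, the relation at [g] just compares the values at [mobius g z] and
   at [z]. *)
have inv g : Gamma1 (q1 * q2) g ->
    \sum_(k < n) c' k * eichler_series (s k).1 (s k).2 (mobius g z) =
    \sum_(k < n) c' k * eichler_series (s k).1 (s k).2 z.
  move=> hg; apply/eqP; rewrite -subr_eq0 -sumrB -[X in _ == X](rel g hg); apply/eqP.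
  apply: eq_bigr => k _.
  by rewrite /newform_dedekind_sum (psi_Gamma1 hq1 hq2 (d1 k) (d2 k) hg) /c' /w; ring.
pose d k := c' k * gauss_sum q2 (conj_character (s k).2) * L k.
have rel1 := relation_all_residues hq1 hq2 d1 d2 (d := d)
  (fun m h m0 co => cusp_relation hq1 hq2 hz d1 p2 Lb inv m0 co).
(* These are multiplicative on pairs of integers; their values at [(m, 1)] and [(1, m)] recover both
   characters, so distinct indices give distinct functions. *)
pose X k (u : int * int) := (s k).1 u.1 * (s k).2 u.2.
have d0 k : d k = 0.
  apply: (@characters_independent R[i] (int * int)%type
    (fun u w => (u.1 * w.1, u.2 * w.2)) (1, 1) n X d) => [j|j u t|i j hX|[m h]].
  - have [e1 _ _ _] := d1 j; have [e2 _ _ _] := d2 j.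
    by rewrite /X /= e1 e2 mulr1.
  - have [_ e1 _ _] := d1 j; have [_ e2 _ _] := d2 j.
    by rewrite /X /= e1 e2 mulrACA.
  - apply: s_inj; have [e1 _ _ _] := d1 i; have [e2 _ _ _] := d2 i.
    have [e1' _ _ _] := d1 j; have [e2' _ _ _] := d2 j.
    have f1 : (s i).1 = (s j).1.
      by apply/funext => m; have := hX (m, 1); rewrite /X /= e2 e2' !mulr1.
    have f2 : (s i).2 = (s j).2.
      by apply/funext => m; have := hX (1, m); rewrite /X /= e1 e1' !mul1r.
    by rewrite [s i]surjective_pairing f1 f2 -surjective_pairing.
  - exact: rel1.
move=> k; have := d0 k; rewrite /d /c' => /eqP.
by rewrite 3!mulf_eq0 (negPf (L0 k)) (negPf (gauss_sum_neq0 hq2 (p2 k))) (negPf (w0 k)) !orbF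
  => /eqP.
Qed.
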